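(* For every virtual link diagram $D$, $Z_D(x,y)$ is an element of $\mathbb{Z}[x^{\pm 1},y^{\pm 1}]$, and $Z$ is an invariant of virtual links up to multiplication by powers of $x^{\pm 1}$: if $D$ and $D'$ are equivalent virtual link diagrams, then there is an integer $k$ such that $Z_{D}(x,y) = x^{k} Z_{D'}(x,y)$.
   Context: A virtual link diagram is an oriented link diagram in the plane (an oriented 4-valent plane graph, closed curves without vertices being allowed) each of whose crossings is either classical (with over/under information, hence positive or negative in the usual sense) or virtual (no over/under information). At each crossing the two strands pass transversally through each other. Two diagrams are equivalent if they are related by a finite sequence of orientation preserving homeomorphisms of the plane and extended Reidemeister moves, namely: the classical moves I, II, III; the purely virtual moves I', II', III' (moves I, II, III with all crossings involved virtual); and the mixed move III'' (a strand having two virtual crossings with the two strands of a classical crossing is moved across that classical crossing). A virtual link is an equivalence class of virtual link diagrams. Definition of $Z_D$. Let $D$ have $n\ge 1$ classical crossings $c_1,\dots,c_n$. Put $$M_+ = \begin{pmatrix} 1-x & -y \\ -xy^{-1} & 0\end{pmatrix},\qquad M_- = \begin{pmatrix} 0 & -x^{-1}y \\ -y^{-1} & 1-x^{-1}\end{pmatrix}.$$ Let $M_i = M_+$ if $c_i$ is positive and $M_i=M_-$ otherwise, and let $M=\mathrm{diag}(M_1,\dots,M_n)$, a $2n\times 2n$ block diagonal matrix. Ignoring virtual crossings, $D$ gives a graph with $n$ vertices $v_1,\dots,v_n$ (the classical crossings) and $2n$ edges (the arcs connecting two classical crossings, which may intersect in virtual crossings). Subdivide each edge into two half-edges. At $v_i$,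 rotate the picture so that both strands point downwards; label the upper left, upper right (incoming) half-edges $i_l^-$, $i_r^-$ and the lower left, lower right (outgoing) half-edges $i_l^+$, $i_r^+$. A permutation of $\{1,\dots,n\}\times\{l,r\}$ is defined by $(i,a)\mapsto(j,b)$ if the half-edges $i_a^+$ and $j_b^-$ belong to the same edge. Let $P$ be the corresponding $2n\times 2n$ permutation matrix (entry $1$ in column $(i,a)$ and row $(j,b)$ when $(i,a)\mapsto(j,b)$), with rows and columns ordered $(1,l),(1,r),(2,l),(2,r),\dots,(n,l),(n,r)$. Let $w(D)$ be the writhe (number of positive minus number of negative classical crossings), and define $$Z_D(x,y) = (-1)^{w(D)}\det(M-P).$$ If $D$ has no classical crossings, put $Z_D(x,y)=0$.
   Formalization: Z_D is put equal to 0 not only when D has no classical crossings but also whenever some closed curve of D passes through no classical crossing; if such curves were ignored, a move I on a disjoint circle would change a nonzero Z_D to 0. *)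

(* Defs.v *)
From HB Require Import structures.
From Stdlib Require Import Relation_Operators.
From mathcomp Require Import all_boot all_order all_algebra.
From mathcomp Require Import all_classical all_reals all_analysis.

Set Implicit Arguments.
Unset Strict Implicit.
Unset Printing Implicit Defensive.

Import Order.TTheory GRing.Theory Num.Theory.
Import numFieldNormedType.Exports.

Local Open Scope classical_set_scope.
Local Open Scope ring_scope.

Definition plane (R : realType) : Type := (R * R)%type.

Section PlaneTopology.
Variable R : realType.

Definition homeomorphism (h : plane R -> plane R) : Prop :=
  continuous h /\
  exists g : plane R -> plane R, [/\ continuous g, cancel h g & cancel g h].

(* The image under h of the unit circle around p has winding number 1 around
   h p: theta is a continuous determination of its argument. *)
Definition orientation_preserving (h : plane R -> plane R) : Prop :=
  homeomorphism h /\
  forall p : plane R, exists theta r : R -> R,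
    [/\ continuous theta,
        forall t, theta (t + 2 * pi) = theta t + 2 * pi,
        forall t, 0 < r t &
        forall t, h (p.1 + cos t, p.2 + sin t) =
          ((h p).1 + r t * cos (theta t), (h p).2 + r t * sin (theta t))].

Definition sqdist0 (p : plane R) : R := p.1 ^+ 2 + p.2 ^+ 2.

End PlaneTopology.

Definition side : finType := 'I_2.
Definition lft : side := ord0.
Definition rgt : side := ord_max.
Definition opp_side (a : side) : side := rev_ord a.

(* Crossings are looked at with both strands pointing downwards.
   [Classical a]: the strand coming in at the upper side a is the over-strand. *)
Inductive crossing_kind := Classical of side | Virtual.

Definition is_classical (c : crossing_kind) : bool :=
  if c is Classical _ then true else false.

(* In the usual upward picture of a positive crossing the over-strand runs from
   the lower left to the upper right; turned by 180 degrees it comes in at the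
   upper right. *)
Definition is_positive (c : crossing_kind) : bool :=
  if c is Classical a then a == rgt else false.

(* The same strands cross, with over and under exchanged. *)
Definition flip_kind (c : crossing_kind) : crossing_kind :=
  if c is Classical a then Classical (opp_side a) else Virtual.

(* A plane graph is described with crossings X and auxiliary two-valent
   vertices P ("marks") on its edges; a closed curve without crossings carries
   at least one mark. A port (x, a) names both the incoming half-edge at the
   upper side a of x and the outgoing one at the lower side a of x. *)
Definition vertex (X P : finType) : finType := (X + P)%type.
Definition port (X P : finType) : finType := ((X * side) + P)%type.

Definition base (X P : finType) (q : port X P) : vertex X P :=
  match q with inl u => inl u.1 | inr p => inr p end.

Definition vertex_map (X P X' P' : finType) (f : X -> X') (g : P -> P')
    (v : vertex X P) : vertex X' P' :=
  match v with inl x => inl (f x) | inr p => inr (g p) end.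

Definition port_map (X P X' P' : finType) (f : X -> X') (g : P -> P')
    (q : port X P) : port X' P' :=
  match q with inl u => inl (f u.1, u.2) | inr p => inr (g p) end.

(* The strand coming in at port q goes out at port [through q]. *)
Definition through (X P : finType) (q : port X P) : port X P :=
  match q with inl u => inl (u.1, opp_side u.2) | inr p => inr p end.

(* The edge [edge q] leaves the outgoing port q and ends at the incoming port
   [follow q]; only its values on [0, 1] matter. *)
Record diagram_on (R : realType) (X P : finType) := DiagramOn {
  kind : X -> crossing_kind;
  follow : port X P -> port X P;
  pos : vertex X P -> plane R;
  edge : port X P -> R -> plane R }.

Section Validity.
Variables (R : realType) (X P : finType) (D : diagram_on R X P).

Definition side_sign (a : side) : R := if a == lft then -1 else 1.

(* In suitable coordinates of the plane, positively oriented, the crossing x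
   is the crossing of two straight lines pointing downwards. *)
Definition transversal_at (x : X) : Prop :=
  exists phi : plane R -> plane R,
    [/\ orientation_preserving phi,
        phi (pos D (inl x)) = (0, 0),
        forall a : side, \forall t \near (0 : R)^'+, exists2 r : R, 0 < r &
          phi (edge D (inl (x, a)) t) = (side_sign a * r, - r) &
        forall (q : port X P) (a : side), follow D q = inl (x, a) ->
          \forall t \near (1 : R)^'-, exists2 r : R, 0 < r &
            phi (edge D q t) = (side_sign a * r, r)].

Record is_link_diagram : Prop := IsLinkDiagram {
  follow_bij : bijective (follow D);
  pos_inj : injective (pos D);
  arc_continuous : forall q, {within `[0, 1], continuous (edge D q)};
  arc_source : forall q, edge D q 0 = pos D (base q);
  arc_target : forall q, edge D q 1 = pos D (base (follow D q));
  arc_disjoint : forall q q' t t', 0 < t < 1 -> 0 < t' < 1 ->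
    edge D q t = edge D q' t' -> q = q' /\ t = t';
  arc_avoids : forall q t v, 0 < t < 1 -> edge D q t <> pos D v;
  crossing_transversal : forall x, transversal_at x }.

End Validity.

Record virtual_link_diagram (R : realType) := VirtualLinkDiagram {
  crossing : finType;
  mark : finType;
  diagram :> diagram_on R crossing mark;
  diagramP : is_link_diagram diagram }.

(* The homeomorphism h carries D to D', up to reparametrization of edges. The
   sides l, r being determined by the oriented picture, ports are matched with
   their sides. *)
Definition carries (R : realType) (h : plane R -> plane R)
    (X P X' P' : finType) (D : diagram_on R X P) (D' : diagram_on R X' P') :
    Prop :=
  exists (f : X -> X') (g : P -> P'),
    [/\ bijective f /\ bijective g,
        forall x, kind D' (f x) = kind D x,
        forall q, follow D' (port_map f g q) = port_map f g (follow D q),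
        forall v, pos D' (vertex_map f g v) = h (pos D v) &
        forall q, exists alpha : R -> R,
          [/\ {within `[0, 1], continuous alpha},
              forall s t, 0 <= s -> s < t -> t <= 1 -> alpha s < alpha t,
              alpha 0 = 0 /\ alpha 1 = 1 &
              forall t, 0 <= t <= 1 ->
                edge D' (port_map f g q) (alpha t) = h (edge D q t)]].

(* The same diagram, with one more mark at time c on the edge q. *)
Section Subdivide.
Variables (R : realType) (X P : finType) (D : diagram_on R X P).
Variables (q : port X P) (c : R).

Definition old_port (q' : port X (option P)) : option (port X P) :=
  match q' with
  | inl u => Some (inl u)
  | inr (Some p) => Some (inr p)
  | inr None => None
  end.

Definition new_port (q' : port X P) : port X (option P) := port_map id Some q'.

Definition subdivide : diagram_on R X (option P) := {|
  kind := kind D;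
  follow := fun q' =>
    if old_port q' is Some q0
    then if q0 == q then inr None else new_port (follow D q0)
    else new_port (follow D q);
  pos := fun v =>
    match v with
    | inl x => pos D (inl x)
    | inr (Some p) => pos D (inr p)
    | inr None => edge D q c
    end;
  edge := fun q' t =>
    if old_port q' is Some q0
    then if q0 == q then edge D q (c * t) else edge D q0 t
    else edge D q (c + (1 - c) * t) |}.

End Subdivide.

(* Picture in a disc of k oriented strands, each given by the list of incoming
   ports (crossing, side) it meets from its entry to its exit. Knowing the
   sides at the crossings, and that the picture lies in a disc, the lists below
   determine it up to an orientation preserving homeomorphism of the disc. *)
Record picture (k : nat) := Picture {
  pcrossing : finType;
  pkind : pcrossing -> crossing_kind;
  pstrand : 'I_k -> seq (pcrossing * side) }.

Definition uncrossed (k : nat) : picture k :=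
  @Picture k 'I_0 (fun=> Virtual) (fun=> [::]).

(* One strand, with a loop at the side a of its self-crossing. *)
Definition curl (c : crossing_kind) (a : side) : picture 1 :=
  @Picture 1 'I_1 (fun=> c)
    (fun=> [:: (ord0, opp_side a); (ord0, a)]).

Definition two_kinds (c : crossing_kind) (i : 'I_2) : crossing_kind :=
  if i == ord0 then c else flip_kind c.

(* Two strands crossing twice, the same one being over at both crossings. In
   [bigon_anti] the bigon is at the side a of each of the two crossings. *)
Definition bigon_parallel (c : crossing_kind) : picture 2 :=
  @Picture 2 'I_2
    (two_kinds c)
    (fun i => if i == ord0 then [:: (ord0, lft); (ord_max, rgt)]
              else [:: (ord0, rgt); (ord_max, lft)]).

Definition bigon_anti (c : crossing_kind) (a : side) : picture 2 :=
  @Picture 2 'I_2 (two_kinds c)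
    (fun i => if i == ord0 then [:: (ord0, opp_side a); (ord_max, a)]
              else [:: (ord_max, opp_side a); (ord0, a)]).

(* Three lines in general position, indexed cyclically; lines i and i + 1 meet
   at the crossing i, where line i comes in at the side s i; all eight s occur.
   Let d_i direct the line i, so that s i = lft iff det (d_i, d_(i+1)) < 0.
   With the crossing of the lines i + 1 and i - 1 at the origin and the line i
   given by det (d_i, z) = e, the line i meets the line i + 1 at a parameter
   which exceeds that of its meeting with the line i - 1 by
     e * det (d_(i+1), d_(i-1)) / (det (d_i, d_(i+1)) * det (d_i, d_(i-1))).
   The numerator is the same for all i; tau records its sign, which changes when
   one line is moved across the crossing of the other two. *)
Definition triangle (c : 'I_3 -> crossing_kind) (s : 'I_3 -> side)
    (tau : bool) : picture 3 :=
  @Picture 3 'I_3 c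
    (fun i =>
       let after := (i, s i) in
       let before := (ord_pred i, opp_side (s (ord_pred i))) in
       if (s i == s (ord_pred i)) == tau then [:: after; before]
       else [:: before; after]).

(* Crossings allowed in a triangle: all virtual; exactly one classical; all
   classical, the three strands being at three different heights (i.e. the
   relation "over" between them is not cyclic). *)
Definition triangle_kinds (c : 'I_3 -> crossing_kind) (s : 'I_3 -> side) :
    Prop :=
  [\/ forall i, c i = Virtual,
      exists i, is_classical (c i) /\ forall j, j != i -> c j = Virtual |
      exists o : 'I_3 -> side,
        [/\ forall i, c i = Classical (o i),
            exists i, o i = s i &
            exists i, o i <> s i]].

(* The extended Reidemeister moves, for all orientations of the strands. *)
Inductive extended_reidemeister : forall k, picture k -> picture k -> Prop :=
| Move_I c a : extended_reidemeister (uncrossed 1) (curl c a)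
| Move_II_parallel c :
    extended_reidemeister (uncrossed 2) (bigon_parallel c)
| Move_II_anti c a :
    extended_reidemeister (uncrossed 2) (bigon_anti c a)
| Move_III c s tau : triangle_kinds c s ->
    extended_reidemeister (triangle c s tau) (triangle c s (~~ tau)).

(* Leaving from the outgoing port q, one meets the incoming ports in [path],
   and then the incoming port q'. *)
Fixpoint goes_along (X P : finType) (fol : port X P -> port X P)
    (q : port X P) (path : seq (port X P)) (q' : port X P) : Prop :=
  if path is r :: path' then fol q = r /\ goes_along fol (through r) path' q'
  else fol q = q'.

Section LocalMove.
Variables (R : realType) (X P : finType) (k : nat).
(* phi maps the disc in which the move takes place to the unit disc; the
   strands of the picture enter and leave it at the marks [ends (inl i)] and
   [ends (inr i)]. *)
Variables (phi : plane R -> plane R) (ends : 'I_k + 'I_k -> P).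

Definition inner_port (Y : finType) (q : port (X + Y)%type P) : Prop :=
  match q with
  | inl (inl _, _) => False
  | inl (inr _, _) => True
  | inr p => exists i, p = ends (inl i)
  end.

Record shows_inside (L : picture k)
    (D : diagram_on R (X + pcrossing L)%type P) : Prop := ShowsInside {
  inside_kind : forall x, kind D (inr x) = pkind x;
  inside_strand : forall i,
    goes_along (follow D) (inr (ends (inl i)))
      [seq inl (inr u.1, u.2) | u <- pstrand L i] (inr (ends (inr i)));
  inside_ends : forall j, sqdist0 (phi (pos D (inr (ends j)))) = 1;
  inside_crossing : forall x, sqdist0 (phi (pos D (inl (inr x)))) < 1;
  inside_arc : forall q t, inner_port q -> 0 < t < 1 ->
    sqdist0 (phi (edge D q t)) < 1 }.

Record agree_outside (Y Y' : finType) (D : diagram_on R (X + Y)%type P)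
    (D' : diagram_on R (X + Y')%type P) : Prop := AgreeOutside {
  outside_kind : forall x : X, kind D (inl x) = kind D' (inl x);
  outside_pos : forall v : vertex X P,
    pos D (vertex_map inl id v) = pos D' (vertex_map inl id v);
  outside_vertex : forall v : vertex X P, (forall j, v <> inr (ends j)) ->
    1 < sqdist0 (phi (pos D (vertex_map inl id v)));
  outside_arc : forall q : port X P, (forall i, q <> inr (ends (inl i))) ->
    (exists q', follow D (port_map inl id q) = port_map inl id q' /\
                follow D' (port_map inl id q) = port_map inl id q') /\
    forall t, 0 < t < 1 ->
      edge D (port_map inl id q) t = edge D' (port_map inl id q) t /\
      1 < sqdist0 (phi (edge D (port_map inl id q) t)) }.

End LocalMove.

Inductive elementary_equivalence (R : realType) :
    virtual_link_diagram R -> virtual_link_diagram R -> Prop :=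
| Equiv_homeomorphism h (D D' : virtual_link_diagram R) :
    orientation_preserving h -> carries h D D' -> elementary_equivalence D D'
| Equiv_subdivide (D : virtual_link_diagram R) q c
    (subP : is_link_diagram (subdivide D q c)) :
    0 < c < 1 -> elementary_equivalence D (VirtualLinkDiagram subP)
| Equiv_reidemeister (X P : finType) k (L L' : picture k) phi
    (ends : 'I_k + 'I_k -> P)
    (D : diagram_on R (X + pcrossing L)%type P)
    (D' : diagram_on R (X + pcrossing L')%type P)
    (DP : is_link_diagram D) (DP' : is_link_diagram D') :
    extended_reidemeister L L' ->
    orientation_preserving phi -> injective ends ->
    shows_inside phi ends D -> shows_inside phi ends D' ->
    agree_outside phi ends D D' ->
    elementary_equivalence (VirtualLinkDiagram DP) (VirtualLinkDiagram DP').

Definition equivalent (R : realType) :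
    virtual_link_diagram R -> virtual_link_diagram R -> Prop :=
  clos_refl_sym_trans (virtual_link_diagram R) (@elementary_equivalence R).

(* The field Q(x, y), as the fraction field of Z[x][y]. *)
Definition ratfrac : fieldType := {fraction {poly {poly int}}}.
Definition xvar : ratfrac := FracField.tofrac ('X : {poly int})%:P.
Definition yvar : ratfrac := FracField.tofrac ('X : {poly {poly int}}).

Definition is_laurent (z : ratfrac) : Prop :=
  exists (p : {poly {poly int}}) (m n : nat),
    z = FracField.tofrac p / (xvar ^+ m * yvar ^+ n).

Definition mx2 (a b c d : ratfrac) : 'M[ratfrac]_2 :=
  \matrix_(i, j) if i == lft then (if j == lft then a else b)
                 else (if j == lft then c else d).

Definition Mplus : 'M[ratfrac]_2 :=
  mx2 (1 - xvar) (- yvar)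
      (- (xvar * yvar^-1)) 0.

Definition Mminus : 'M[ratfrac]_2 :=
  mx2 0 (- (xvar^-1 * yvar))
      (- yvar^-1) (1 - xvar^-1).

Section Invariant.
Variables (R : realType) (X P : finType) (D : diagram_on R X P).

Definition classical_crossing : {set X} := [set x | is_classical (kind D x)].

Definition cl (i : 'I_#|classical_crossing|) : X := enum_val i.

Definition is_classical_port (q : port X P) : bool :=
  if q is inl (x, _) then is_classical (kind D x) else false.

(* First classical incoming port met when leaving from the outgoing port q;
   #|port X P| steps suffice to reach it if q is classical. *)
Definition next_classical (q : port X P) : port X P :=
  iter #|port X P|
    (fun r => if is_classical_port r then r else follow D (through r))
    (follow D q).

(* Some closed curve of the diagram goes through no classical crossing. *)
Definition has_bare_curve : bool :=
  [exists q : port X P, [forall r : port X P,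
    fconnect (fun u => through (follow D u)) q r ==> ~~ is_classical_port r]].

Definition Mmx : 'M[ratfrac]_(\sum_(i < #|classical_crossing|) 2) :=
  \mxdiag_(i < #|classical_crossing|)
    (if is_positive (kind D (cl i)) then Mplus else Mminus).

Definition Pmx : 'M[ratfrac]_(\sum_(i < #|classical_crossing|) 2) :=
  \mxblock_(j < #|classical_crossing|, i < #|classical_crossing|)
    (\matrix_(b < 2, a < 2)
       (next_classical (inl (cl i, a)) == inl (cl j, b))%:R).

Definition writhe : int :=
  \sum_(x in classical_crossing) (if is_positive (kind D x) then 1 else -1).

(* The determinant describes the graph with the classical crossings as vertices
   only if all its closed curves have vertices. Otherwise the convention is 0,
   as for diagrams without classical crossings: a kink in a closed curve
   without other classical crossings contributes a factor
   det (Mplus - 1) = det (Mminus - 1) = 0. *)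
Definition ZD : ratfrac :=
  if (#|classical_crossing| == 0%N) || has_bare_curve then 0
  else (-1) ^ writhe * \det (Mmx - Pmx).

End Invariant.

(* Main.v *)
Require Import Defs.
From mathcomp Require Import all_boot all_order all_fingroup all_algebra.
From mathcomp Require Import all_classical all_reals all_analysis.
From mathcomp Require Import ring zify.

Set Implicit Arguments.
Unset Strict Implicit.
Unset Printing Implicit Defensive.

Import Order.TTheory GRing.Theory Num.Theory.

Local Open Scope ring_scope.

(** The topology of a diagram matters only through its combinatorics: which
    incoming port each outgoing port is joined to, and the kinds of the
    crossings. Think of a column vector as a labelling of the outgoing
    half-edges. The rows of M - P say that, at a classical crossing, the labels
    carried in by the edges are the combinations M of the labels going out.
    Followed along a strand, this becomes asymmetric: on the over-strand the
    incoming label is a multiple ([weight]) of the outgoing one; on the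
    under-strand there is also a multiple ([jump]) of the label with which the
    over-strand goes out. Virtual crossings and marks transmit labels
    unchanged. [strand_mx] is the resulting square matrix B over all ports.

    First, ZD = det B for every nonempty diagram ([ZD_det]). A closed curve
    without classical crossings gives a nonzero vector in the kernel of B. If
    there is none, the ports which are not classical can be eliminated, and this
    leaves M - P with the two columns of each classical crossing exchanged; the
    sign of that permutation is the sign (-1)^w in the definition of ZD.

    Second, det B can be computed tangle by tangle ([glue_det]). If the rows
    inside a disc can be solved for the inner labels in terms of the labels
    entering the disc, then det B is the product of the determinant of the
    inner block and of the determinant of an outer matrix, and the latter sees
    the tangle only through the map from the entering to the leaving labels.
    Hence two pictures can be exchanged, up to a power of x, once they induce
    the same map and their inner determinants differ by a power of x
    ([interchangeable]).

    Third, this is checked for each move. In the bigons and triangles the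
    strands lie at different heights. The labels are found strand by strand from
    the top one to the bottom one, as a strand is influenced only by the strands
    above it; for the same reason the inner block is triangular, and its
    determinant is the product over the crossings of the products of their two
    weights, which are x, 1/x or 1 ([tangle_det]). The curl crosses itself and
    is treated directly; it is where powers of x appear. Adding a mark is
    again an elimination ([diagram_det_subdivide]), and a homeomorphism only
    renames the ports ([diagram_det_carries]). *)

(** * Determinants over finite index types *)

Section FiniteDeterminant.
Variable F : fieldType.

(** Reindexing along any bijection ([detf_reindex]) makes the enumeration
    order irrelevant, so that matrices can be indexed by ports. *)
Definition detf (T : finType) (B : T -> T -> F) : F :=
  \det (\matrix_(i, j < #|T|) B (enum_val i) (enum_val j)).

Lemma eq_detf (T : finType) (B B' : T -> T -> F) :
  (forall t t', B t t' = B' t t') -> detf B = detf B'.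
Proof. by move=> eqB; congr (\det _); apply/matrixP=> i j; rewrite !mxE. Qed.

Lemma det_reindex m n (A : 'M[F]_m) (g : 'I_n -> 'I_m) :
  bijective g -> \det (\matrix_(i, j) A (g i) (g j)) = \det A.
Proof.
move=> bij_g; have eq_nm : n = m by have := bij_eq_card bij_g;
  rewrite !card_ord.
subst n; pose s := perm (bij_inj bij_g).
have -> : \matrix_(i, j) A (g i) (g j) = row_perm s (col_perm s A).
  by apply/matrixP=> i j; rewrite !mxE !permE.
rewrite row_permE col_permE !det_mulmx !det_perm odd_permV mulrC.
by rewrite -mulrA -signr_addb addbb mulr1.
Qed.

Lemma detf_ord (T : finType) n (B : T -> T -> F) (g : 'I_n -> T) :
  bijective g -> \det (\matrix_(i, j) B (g i) (g j)) = detf B.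
Proof.
move=> bij_g.
rewrite /detf -(@det_reindex _ _ _ (enum_rank \o g)); last first.
  exact: bij_comp (@enum_rank_bij T) bij_g.
by congr (\det _); apply/matrixP=> i j; rewrite !mxE /= !enum_rankK.
Qed.

Lemma detf_reindex (T T' : finType) (B : T' -> T' -> F) (h : T -> T') :
  bijective h -> detf (fun t t' => B (h t) (h t')) = detf B.
Proof.
move=> bij_h; rewrite -(detf_ord B (bij_comp bij_h (@enum_val_bij T))).
by congr (\det _); apply/matrixP=> i j; rewrite !mxE.
Qed.

Lemma detf_tr (T : finType) (B : T -> T -> F) : detf (fun t t' => B t' t) =
  detf B.
Proof. by rewrite /detf -det_tr; congr (\det _); apply/matrixP=> i j;
  rewrite !mxE. Qed.

Lemma detf_mul (T : finType) (A B : T -> T -> F) :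
  detf (fun t t' => \sum_u A t u * B u t') = detf A * detf B.
Proof.
rewrite /detf -det_mulmx; congr (\det _); apply/matrixP=> i j; rewrite !mxE.
rewrite (reindex (@enum_val T T)); last exact: onW_bij (@enum_val_bij T).
by apply: eq_bigr => k _; rewrite !mxE.
Qed.

(** A triangular matrix whose index set carries only a rank, not an order: a
    permutation which contributes to the Leibniz sum never increases the rank,
    and as the total rank is preserved it must fix every index. *)
Lemma detf_layered (T : finType) (B : T -> T -> F) (h : T -> nat) :
  (forall t t', B t t' != 0 -> t = t' \/ (h t' < h t)%N) ->
  detf B = \prod_t B t t.
Proof.
move=> layered; rewrite /detf /determinant (bigD1 1%g) //= [X in _ + X]big1
  ?addr0.
  rewrite odd_perm1 expr0 mul1r [RHS](reindex (@enum_val T T));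
    last exact: onW_bij (@enum_val_bij T).
  by apply: eq_bigr => i _; rewrite mxE perm1.
move=> s; apply: contra_neq_eq => nz; apply/permP=> i; rewrite perm1.
have step j : s j = j \/ (h (enum_val (s j)) < h (enum_val j))%N.
  have nzj : B (enum_val j) (enum_val (s j)) != 0.
    by apply: contraNneq nz => Bj0; rewrite (bigD1 j) //= mxE Bj0 mul0r mulr0.
  by case: (layered _ _ nzj) => [/enum_val_inj {2}->|]; [left|right].
have eq_sum : (\sum_(j < #|T|) h (enum_val (s j)) = \sum_(j < #|T|) h
  (enum_val j))%N.
  by rewrite [RHS](reindex_inj (@perm_inj _ s)).
case: (step i) => // lt_i; exfalso; move: eq_sum; apply/eqP; rewrite neq_ltn.
apply/orP; left; rewrite (bigD1 i) //= [ltnRHS](bigD1 i) //= -addSn leq_add //.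
by apply: leq_sum => j _; case: (step j) => [->|/ltnW].
Qed.

Lemma detf_ublock (O I : finType) (C : O + I -> O + I -> F) :
  (forall i o, C (inr i) (inl o) = 0) ->
  detf C = detf (fun o o' => C (inl o) (inl o')) *
           detf (fun i i' => C (inr i) (inr i')).
Proof.
move=> C0.
pose g (k : 'I_(#|O| + #|I|)) : O + I :=
  match fintype.split k with inl a => inl (enum_val a) | inr b => inr
    (enum_val b) end.
have gl a : g (lshift _ a) = inl (enum_val a).
  by rewrite /g -[lshift _ _]/(unsplit (inl a)) unsplitK.
have gr b : g (rshift _ b) = inr (enum_val b).
  by rewrite /g -[rshift _ _]/(unsplit (inr b)) unsplitK.
have bij_g : bijective g.
  exists (fun u => match u with inl o => lshift _ (enum_rank o)
                              | inr i => rshift _ (enum_rank i) end).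
    by move=> k; rewrite /g; case: splitP => j kj; apply: val_inj;
      rewrite /= enum_valK.
  by case=> u; rewrite ?gl ?gr enum_rankK.
rewrite -(detf_ord C bij_g) -[X in \det X]submxK.
have -> : dlsubmx (\matrix_(i, j) C (g i) (g j)) = 0.
  by apply/matrixP=> i j; rewrite !mxE gl gr.
rewrite det_ublock; congr (_ * _); rewrite /detf; congr (\det _);
  apply/matrixP=> i j;
  by rewrite !mxE ?gl ?gr.
Qed.

Lemma detf_id (T : finType) : detf (fun t t' : T => (t == t')%:R) = 1 :> F.
Proof.
rewrite /detf -[RHS](det1 _ #|T|); congr (\det _); apply/matrixP=> i j.
by rewrite !mxE (inj_eq enum_val_inj).
Qed.

(** Elimination of the indices in I. Each column of S lists a combination of
    the columns of B whose entries in the rows of I vanish; these combinations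
    replace the columns of O by a unimodular operation, and B becomes block
    triangular. The inner block need not be invertible. *)
Lemma detf_reduce (O I T : finType) (fg : O + I -> T) (B : T -> T -> F)
    (S : T -> O -> F) :
  bijective fg ->
  (forall o o', S (fg (inl o)) o' = (o == o')%:R) ->
  (forall i o, \sum_t B (fg (inr i)) t * S t o = 0) ->
  detf B = detf (fun o o' => \sum_t B (fg (inl o)) t * S t o') *
           detf (fun i i' => B (fg (inr i)) (fg (inr i'))).
Proof.
move=> bij_fg S1 BS0; rewrite -(detf_reindex B bij_fg).
(* The columns of S, completed by the basis vectors of I. *)
pose U (b c : O + I) : F :=
  match c with inl o => S (fg b) o | inr _ => (b == c)%:R end.
have detU : detf U = 1.
  rewrite -detf_tr detf_ublock => [|i o]; last by [].
  rewrite -[RHS]mulr1 -{2}(detf_id I) -{1}(detf_id O); congr (_ * _).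
    by apply: eq_detf => o o'; rewrite /U S1 eq_sym.
  by apply: eq_detf => i i'; rewrite /U eq_sym.
rewrite -[LHS]mulr1 -detU -detf_mul detf_ublock.
  congr (_ * _); apply: eq_detf => a b.
    by rewrite [RHS](reindex fg) //; exact: onW_bij.
  rewrite (bigD1 (inr b)) //= eqxx mulr1 big1 ?addr0 // => c /negPf ->.
  by rewrite mulr0.
by move=> i o; rewrite -[RHS](BS0 i o) [RHS](reindex fg) //; exact: onW_bij.
Qed.

Lemma detf_kernel (T : finType) (B : T -> T -> F) (v : T -> F) t0 :
  v t0 != 0 -> (forall t, \sum_u B t u * v u = 0) -> detf B = 0.
Proof.
move=> v0 Bv; rewrite -detf_tr; apply/eqP/det0P.
exists (\row_i v (enum_val i)).
  apply: contraNneq v0 => /rowP/(_ (enum_rank t0)).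
  by rewrite !mxE enum_rankK => ->.
apply/rowP=> i; rewrite !mxE -[RHS](Bv (enum_val i)).
rewrite [RHS](reindex (@enum_val T T)); last exact: onW_bij (@enum_val_bij T).
by apply: eq_bigr => k _; rewrite !mxE mulrC.
Qed.

End FiniteDeterminant.

(** * The strand matrix and gluing of tangles *)

Section StrandMatrix.
Variables (F : fieldType) (x y : F).

(** M_+ and M_- read along strands: on the strand coming in at the side b, the
    label coming in is [weight] times the label going out (at the opposite lower
    side), plus, under the other strand, [jump] times the label with which that
    strand goes out, at the lower side b. *)
Definition weight (c : crossing_kind) (b : side) : F :=
  match c with
  | Classical a =>
      if a == rgt then (if b == rgt then - (x / y) else - y)
      else (if b == rgt then - y^-1 else - (y / x))
  | Virtual => 1
  end.

Definition jump (c : crossing_kind) (b : side) : F :=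
  if c is Classical a
  then if b == a then 0 else if a == rgt then 1 - x else 1 - x^-1
  else 0.

Definition twin (Y : finType) (u : Y * side) : Y * side := (u.1, opp_side u.2).

Section Ports.
Variables (X P : finType) (kd : X -> crossing_kind).
Variable fol : port X P -> port X P.

Definition port_weight (q : port X P) : F :=
  if q is inl u then weight (kd u.1) u.2 else 1.

Definition port_jump (q : port X P) : F :=
  if q is inl u then jump (kd u.1) u.2 else 0.

(** The column t stands for the outgoing half-edge of the strand which comes in
    at t, that is for the outgoing port [through t]. This choice puts the
    weights on the diagonal. *)
Definition strand_mx (q t : port X P) : F :=
  port_weight q * (t == q)%:R + port_jump q * (t == through q)%:R
  - (fol (through t) == q)%:R.

Lemma throughK : involutive (@through X P).
Proof. by case=> [[z a]|p] //=; rewrite /opp_side rev_ordK. Qed.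

Lemma strand_mx_sum (S : port X P -> F) q t :
  injective fol -> fol t = q ->
  \sum_u strand_mx q u * S u =
    port_weight q * S q + port_jump q * S (through q) - S (through t).
Proof.
move=> inj_fol fol_t; rewrite /strand_mx.
under eq_bigr do rewrite mulrBl mulrDl -!mulrA.
rewrite sumrB big_split /= -!mulr_sumr.
have pick (q0 : port X P) : \sum_i (i == q0)%:R * S i = S q0.
  rewrite (bigD1 q0) //= eqxx mul1r big1 ?addr0 // => i /negPf ->.
  by rewrite mul0r.
rewrite !pick; congr (_ - _); rewrite -[RHS]pick; apply: eq_bigr => i _.
by rewrite -fol_t (inj_eq inj_fol) (can2_eq throughK throughK).
Qed.

End Ports.

Section Tangle.
Variables (k : nat) (L : picture k).
Local Notation Y := (pcrossing L).

(** The labels S solve the rows of a strand of the picture which is entered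
    with the label u; they leave it with the label w. *)
Fixpoint flows (S : Y * side -> F) (u : F) (path : seq (Y * side)) (w : F)
    : Prop :=
  if path is r :: path' then
    weight (pkind r.1) r.2 * S r + jump (pkind r.1) r.2 * S (twin r) = u /\
    flows S (S r) path' w
  else u = w.

Definition covered : Prop := forall u : Y * side, exists i, u \in pstrand L i.

(** The block of the strand matrix whose rows and columns are the ports of the
    crossings of the picture; it depends on the picture only, by
    [inner_step]. *)
Definition tangle_mx (u t : Y * side) : F :=
  weight (pkind u.1) u.2 * (t == u)%:R + jump (pkind u.1) u.2 * (t == twin u)%:R
  - [exists i, infix [:: t; u] (pstrand L i)]%:R.

End Tangle.

Section Gluing.
Variables (R : realType) (X P : finType) (k : nat) (ends : 'I_k + 'I_k -> P).
Variables (L : picture k) (D : diagram_on R (X + pcrossing L)%type P).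
Local Notation Y := (pcrossing L).
Local Notation T := (port (X + Y)%type P).

Definition outer_emb (q : port X P) : T := port_map inl id q.
Definition inner_emb (u : Y * side) : T := inl (inr u.1, u.2).

Definition is_end (q : port X P) : bool := [exists i, q == inr (ends (inl i))].

(** What is left of the strand matrix after the inside has been eliminated. The
    column of a port o is the response to the label 1 at o and 0 at the other
    outer ports, and w o i is the label leaving the disc along the i-th strand;
    the marks at which strands enter are excluded from the first sum, since what
    goes out of them is recorded by w. *)
Definition outer_mx (w : port X P -> 'I_k -> F) (q o : port X P) : F :=
  port_weight (fun z => kind D (inl z)) q * (q == o)%:R
  + port_jump (fun z => kind D (inl z)) q * (through q == o)%:R
  - (\sum_(r | ~~ is_end r)
       (follow D (outer_emb r) == outer_emb q)%:R * (through r == o)%:R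
     + \sum_i (q == inr (ends (inr i)))%:R * w o i).

Hypothesis inj_ends : injective ends.
Hypothesis bij_follow : bijective (follow D).
Hypothesis kind_inside : forall z, kind D (inr z) = pkind z.
Hypothesis strand_inside : forall i,
  goes_along (follow D) (inr (ends (inl i)))
    [seq inl (inr u.1, u.2) | u <- pstrand L i] (inr (ends (inr i))).
Hypothesis cov : covered L.

Local Notation inj_follow := (bij_inj bij_follow).

Lemma outer_emb_inj : injective outer_emb.
Proof. by move=> [[z a]|p] [[z' a']|p'] //= [] => [-> ->|->]. Qed.

Lemma inner_emb_inj : injective inner_emb.
Proof. by move=> [z a] [z' a'] [] /= -> ->. Qed.

Lemma through_outer q : through (outer_emb q) = outer_emb (through q).
Proof. by case: q => [[z a]|p]. Qed.

Lemma through_inner u : through (inner_emb u) = inner_emb (twin u).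
Proof. by case: u. Qed.

(** Translates the equations of a strand into rows of the strand matrix: the
    label coming in at each port of the strand, and at the mark where it leaves
    the disc, is the label going out of the port which precedes it. *)
Lemma flows_along (S' : T -> F) (S : Y * side -> F) q path q' u w :
  (forall v, S' (inner_emb v) = S v) ->
  inner_port ends q -> S' (through q) = u ->
  goes_along (follow D) q [seq inl (inr v.1, v.2) | v <- path] q' ->
  flows S u path w ->
  (exists t, [/\ inner_port ends t, follow D t = q' & S' (through t) = w]) /\
  (forall v, v \in path -> exists t,
     follow D t = inner_emb v /\
     weight (pkind v.1) v.2 * S v + jump (pkind v.1) v.2 * S (twin v) =
       S' (through t)).
Proof.
move=> S'E; elim: path q u => [|r path IH] q u qin S'q /=.
  by move=> fq <-; split=> //; exists q.
move=> [fq along] [Sr flow].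
have rE : inl (inr r.1, r.2) = inner_emb r by case: (r).
have := IH (through (inner_emb r)) (S r).
rewrite throughK S'E => /(_ I erefl along flow) [last_t mid_t].
split=> // v; rewrite inE => /predU1P[->|/mid_t //].
by exists q; rewrite fq rE Sr S'q.
Qed.

Lemma along_next q path q' v :
  goes_along (follow D) q [seq inl (inr v.1, v.2) | v <- path] q' ->
  v \in path ->
  (exists2 v', infix [:: v; v'] path &
     follow D (through (inner_emb v)) = inner_emb v') \/
  follow D (through (inner_emb v)) = q'.
Proof.
elim: path q => [//|r path IH] q /= [fq along].
rewrite inE => /predU1P[->|vin].
  case: path along {IH} => [|r' path] /= => [|[]] along; first by right.
  move=> _; left; exists r'; last exact: along.
  by rewrite /= !eqxx prefix0s.
case: (IH _ along vin) => [[v' inf fv]|]; last by right.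
by left; exists v' => //; rewrite inf orbT.
Qed.

Lemma along_infix q path q' v v' :
  goes_along (follow D) q [seq inl (inr v.1, v.2) | v <- path] q' ->
  infix [:: v; v'] path ->
  follow D (through (inner_emb v)) = inner_emb v'.
Proof.
move=> along /infixP[p [s pathE]]; move: along; rewrite {}pathE.
by elim: p q => [|r p IH] q /= => [[_ []]|[_ /IH]].
Qed.

(** Nothing leaves the disc except along the prescribed strands; this is where
    it matters that they pass through all inner ports. *)
Lemma inner_next t : inner_port ends t ->
  (exists v, follow D t = inner_emb v) \/
  exists i, follow D t = inr (ends (inr i)).
Proof.
case: t => [[[z|z] a] //= _|p /= [i ->]].
  have [i zin] := cov (z, opp_side a).
  have := along_next (strand_inside i) zin.
  rewrite /= /opp_side rev_ordK => -[[v _ fv]|fv]; [left|right].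
    by exists v.
  by exists i.
have := strand_inside i; case: (pstrand L i) => [|v s] /= => [|[]] fi.
  by right; exists i.
by move=> _; left; exists v.
Qed.

Lemma inner_step v v' :
  (follow D (through (inner_emb v)) == inner_emb v') =
  [exists i, infix [:: v; v'] (pstrand L i)].
Proof.
apply/eqP/existsP => [fv|[i /(along_infix (strand_inside i))//]].
have [i vin] := cov v; exists i.
case: (along_next (strand_inside i) vin) => [[v'' inf]|]; rewrite fv //.
by move/inner_emb_inj ->.
Qed.

Definition glue (a : port X P + Y * side) : T :=
  match a with inl q => outer_emb q | inr u => inner_emb u end.

Lemma glue_bij : bijective glue.
Proof.
exists (fun t : T => match t with
  | inl (inl z, a) => inl (inl (z, a))
  | inl (inr z, a) => inr (z, a)
  | inr p => inl (inr p) end).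
  by case=> [[[z a]|p]|[z a]].
by case=> [[[z|z] a]|p].
Qed.

(** S o solves the inner rows for the label 1 at the outer port o and 0 at the
    other ones, so [detf_reduce] applies, the inner ports being eliminated. *)
Theorem glue_det (S : port X P -> Y * side -> F) (w : port X P -> 'I_k -> F) :
  (forall o i, flows (S o) (o == inr (ends (inl i)))%:R (pstrand L i) (w o i))
    ->
  detf (strand_mx (kind D) (follow D)) =
    detf (outer_mx w) * detf (@tangle_mx k L).
Proof.
move=> flowS.
pose S' (t : T) (o : port X P) : F :=
  match t with
  | inl (inl z, a) => (inl (z, a) == o)%:R
  | inl (inr z, a) => S o (z, a)
  | inr p => (inr p == o)%:R
  end.
have S'out q o : S' (outer_emb q) o = (q == o)%:R by case: q => [[]|].
have S'in u o : S' (inner_emb u) o = S o u by case: u.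
have S'mark o i :
    S' (through (inr (ends (inl i)))) o = (o == inr (ends (inl i)))%:R.
  by rewrite /= eq_sym.
have along o i := @flows_along (S'^~ o) (S o) (inr (ends (inl i))) _ _ _ _
  (S'in^~ o) (ex_intro _ i erefl) (S'mark o i) (strand_inside i) (flowS o i).
rewrite (detf_reduce glue_bij (S := S')); first last.
- move=> u o; rewrite -[glue (inr u)]/(inner_emb u).
  have [i ui] := cov u; have [_ /(_ u ui)[t [ft eqt]]] := along o i.
  rewrite (strand_mx_sum _ _ inj_follow ft) through_inner !S'in -eqt.
  by rewrite /= kind_inside subrr.
- by move=> o o' /=; rewrite S'out.
congr (_ * _); apply: eq_detf => a b /=; last first.
  rewrite /strand_mx /tangle_mx inner_step through_inner !(inj_eq
    inner_emb_inj).
  by rewrite /= kind_inside.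
have [g gK Kg] := bij_follow; have ft := Kg (outer_emb a).
rewrite (strand_mx_sum _ _ inj_follow ft) through_outer !S'out /outer_mx.
have -> : port_weight (kind D) (outer_emb a) =
          port_weight (fun z => kind D (inl z)) a by case: (a).
have -> : port_jump (kind D) (outer_emb a) =
          port_jump (fun z => kind D (inl z)) a by case: (a).
congr (_ - _); set t := g _ in ft *.
(* The port t precedes a. If a is the end of a strand, then t is the last port
   of that strand; otherwise t lies outside, and is not the start of one. *)
case: (pickP (fun i => a == inr (ends (inr i)))) => [i /eqP aE|a_nend].
  have [[t' [t'in ft' /= S't']] _] := along b i.
  have -> : t = t' by apply: inj_follow; rewrite ft ft' aE.
  rewrite {}S't'.
  rewrite big1 ?add0r => [|r r_nend].
    rewrite (bigD1 i) //= aE eqxx mul1r big1 ?addr0 // => j ji.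
    case: eqP => [[/inj_ends[ij]]|]; last by rewrite mul0r.
    by rewrite ij eqxx in ji.
  case: eqP => [fr|]; last by rewrite mul0r.
  have rt : outer_emb r = t' by apply: inj_follow; rewrite ft' fr aE.
  case/negP: r_nend; move: t'in; rewrite -rt; case: (r) => [[]//|p] /= [j ->].
  by apply/existsP; exists j.
rewrite [X in _ + X]big1 ?addr0 => [|i _]; last by rewrite a_nend mul0r.
have t_outer : ~ inner_port ends t.
  case/inner_next; rewrite ft => -[]; first by case: (a) => [[]|] //= ? ? [].
  by move=> i aE; have := a_nend i;
    rewrite (outer_emb_inj (x2 := inr _) aE) eqxx.
have [r tE] : exists r, t = outer_emb r.
  case: (t) t_outer => [[[z|z] c]|p] nin; last by exists (inr p).
    by exists (inl (z, c)).
  by case: nin.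
rewrite tE through_outer S'out (bigD1 r) /=; last first.
  apply/existsP=> -[i /eqP rE]; apply: t_outer; rewrite tE rE.
  by exists i.
rewrite -ft tE eqxx mul1r big1 ?addr0 // => r' /andP[_ r'r].
case: eqP => [/inj_follow/outer_emb_inj rr|]; last by rewrite mul0r.
by rewrite rr eqxx in r'r.
Qed.

End Gluing.
End StrandMatrix.

(** * Pictures at different heights; curls and bigons *)

Section Weights.
Variables (F : fieldType) (x y : F).
Hypotheses (x0 : x != 0) (y0 : y != 0).
Local Notation weight := (weight x y).
Local Notation jump := (jump x).

Lemma sideP (a : side) : a = lft \/ a = rgt.
Proof. by case: a => [[|[|]]] // lt; [left|right]; apply: val_inj. Qed.

Lemma opp_lft : opp_side lft = rgt. Proof. exact: val_inj. Qed.
Lemma opp_rgt : opp_side rgt = lft. Proof. exact: val_inj. Qed.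
Lemma lft_eq_rgt : (lft == rgt) = false. Proof. by []. Qed.
Lemma rgt_eq_lft : (rgt == lft) = false. Proof. by []. Qed.
Definition side_simpl :=
  (opp_lft, opp_rgt, lft_eq_rgt, rgt_eq_lft, eqxx lft, eqxx rgt).

Lemma opp_sideK : involutive opp_side. Proof. exact: rev_ordK. Qed.
Lemma opp_neq a : (opp_side a == a) = false.
Proof. by case: (sideP a) => ->; rewrite side_simpl. Qed.

Lemma crossing_entries (o a b : side) :
  (if o == rgt
   then if b == lft then (if a == lft then 1 - x else - y)
        else if a == lft then - (x * y^-1) else 0
   else if b == lft then (if a == lft then 0 else - (x^-1 * y))
        else if a == lft then - y^-1 else 1 - x^-1) =
  weight (Classical o) (opp_side a) * (b == opp_side a)%:R
  + jump (Classical o) a * (b == a)%:R.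
Proof.
by case: (sideP o) (sideP a) (sideP b) => -> [] -> [] ->;
  rewrite /= ?side_simpl /= ?mulr1 ?mulr0 ?addr0 ?add0r // [_ / _]mulrC.
Qed.

Lemma weight_neq0 c b : weight c b != 0.
Proof.
have nz := (mulf_neq0, invr_neq0, oppr_eq0).
by case: c => [a|] /=; rewrite ?oner_eq0 //; do 2 case: ifP => _;
  rewrite !nz ?x0 ?y0.
Qed.

Definition crossing_det (c : crossing_kind) : F :=
  if c is Classical a then if a == rgt then x else x^-1 else 1.

Lemma weight_lr c : weight c lft * weight c rgt = crossing_det c.
Proof.
case: c => [a|] /=; last by rewrite mulr1.
by rewrite ?side_simpl; case: ifP => _; field; rewrite ?x0 ?y0.
Qed.

Lemma crossing_det_flip c : crossing_det c * crossing_det (flip_kind c) = 1.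
Proof.
case: c => [a|] /=; last by rewrite mulr1.
by case: (sideP a) => ->; rewrite /= ?side_simpl (mulVf, mulfV).
Qed.

Lemma crossing_det_power c : exists n : int, crossing_det c = x ^ n.
Proof.
case: c => [a|] /=; last by exists 0.
by case: ifP => _; [exists 1 | exists (-1)].
Qed.

Lemma jump_neq0 c b :
  jump c b != 0 -> if c is Classical a then a == opp_side b else false.
Proof.
case: c => [a|] /=; last by rewrite eqxx.
by case: (sideP a) (sideP b) => -> [] ->; rewrite ?side_simpl ?eqxx.
Qed.

Lemma prod_ports (Y : finType) (f : Y * side -> F) :
  \prod_u f u = \prod_z (f (z, lft) * f (z, rgt)).
Proof.
rewrite (eq_bigr (fun u => f (u.1, u.2))) => [|[]//].
rewrite -(pair_bigA _ (fun z a => f (z, a))) /=.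
by apply: eq_bigr => z _; rewrite !big_ord_recl big_ord0 mulr1;
  congr (_ * f (_, _)); apply: val_inj.
Qed.

(** The inner block is triangular as soon as some rank h increases along each
    strand and from the over-strand to the under-strand at each crossing, which
    means that the strands can be put at different heights. *)
Lemma tangle_det k (L : picture k) (h : pcrossing L * side -> nat) :
  (forall u : pcrossing L * side,
    jump (pkind u.1) u.2 != 0 -> (h (twin u) < h u)%N) ->
  (forall i, sorted (relpre h ltn) (pstrand L i)) ->
  detf (@tangle_mx F x y k L) = \prod_(z : pcrossing L) crossing_det (pkind z).
Proof.
move=> h_jump h_strand.
have h_infix t u : [exists i, infix [:: t; u] (pstrand L i)] -> (h t < h u)%N.
  case/existsP => i /infixP[p [s E]]; have := h_strand i; rewrite E.
  by case/cat_sorted2 => _ /cat_sorted2[/andP[]].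
rewrite (@detf_layered _ _ _ h) => [|u t nz].
  under [RHS]eq_bigr do rewrite -weight_lr.
  rewrite -(prod_ports (fun u : pcrossing L * side => weight (pkind u.1) u.2)).
  apply: eq_bigr => -[z a] _; rewrite /tangle_mx eqxx mulr1 /twin /=.
  have -> : ((z, a) == (z, opp_side a)) = false.
    by rewrite xpair_eqE [a == _]eq_sym opp_neq andbF.
  case: existsP => [/existsP/h_infix|_]; first by rewrite ltnn.
  by rewrite mulr0 addr0 subr0.
have [->|tu] := eqVneq t u; first by left.
right; move: nz; rewrite /tangle_mx (negPf tu) mulr0 add0r.
case inf: [exists i, _]; first by move/h_infix: inf.
rewrite subr0 mulf_eq0 negb_or => /andP[/h_jump].
by have [->|_] := eqVneq t; rewrite ?eqxx.
Qed.

(** Both pictures can be solved for every choice u of entering labels, with the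
    same leaving labels w. *)
Definition same_transfer k (L L' : picture k) : Prop :=
  forall u : 'I_k -> F, exists w : 'I_k -> F,
    (exists S, forall i, @flows F x y k L S (u i) (pstrand L i) (w i)) /\
    (exists S, forall i, @flows F x y k L' S (u i) (pstrand L' i) (w i)).

Definition interchangeable k (L L' : picture k) : Prop :=
  [/\ covered L, covered L', same_transfer L L' &
    exists n : int, detf (@tangle_mx F x y k L') =
                    x ^ n * detf (@tangle_mx F x y k L)].

Lemma uncrossed_det k : detf (@tangle_mx F x y k (uncrossed k)) = 1.
Proof.
by rewrite (@tangle_det _ _ (fun=> 0%N)) ?big_ord0 // => -[[]].
Qed.

Lemma uncrossed_covered k : covered (uncrossed k).
Proof. by case=> [[]]. Qed.

(** [flip_weight] and [flip_jump] are the entries of M_c M_c' = 1, where c' is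
    the crossing c with over and under exchanged. *)
Lemma flip_weight c a :
  weight c a * weight (flip_kind c) (opp_side a)
  + jump c a * jump (flip_kind c) a = 1.
Proof.
case: c => [b|] /=; last by rewrite mulr1 mulr0 addr0.
case: (sideP a) (sideP b) => -> [] ->; rewrite /= ?side_simpl; field;
  by rewrite ?x0 ?y0.
Qed.

Lemma flip_jump c a :
  weight c a * jump (flip_kind c) (opp_side a)
  + jump c a * weight (flip_kind c) a = 0.
Proof.
case: c => [b|] /=; last by rewrite mulr0 mul0r addr0.
case: (sideP a) (sideP b) => -> [] ->; rewrite /= ?side_simpl; field;
  by rewrite ?x0 ?y0.
Qed.

End Weights.

Section CurlAndBigons.
Variables (F : fieldType) (x y : F).
Hypotheses (x0 : x != 0) (y0 : y != 0).
Local Notation weight := (weight x y).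
Local Notation jump := (jump x).
Local Notation crossing_det := (crossing_det x).
Local Notation weight_neq0 := (weight_neq0 x0 y0).

Lemma uncrossed_flows k (u : 'I_k -> F) :
  exists S, forall i, @flows F x y k (uncrossed k) S (u i) [::] (u i).
Proof. by exists (fun=> 0). Qed.

Lemma detf_two (T : finType) (B : T -> T -> F) (t0 t1 : T) :
  t0 != t1 -> (forall t, t = t0 \/ t = t1) ->
  detf B = B t0 t0 * B t1 t1 - B t0 t1 * B t1 t0.
Proof.
move=> t01 t_cases; pose g (i : 'I_2) := if i == lft then t0 else t1.
have bij_g : bijective g.
  exists (fun t => if t == t0 then lft else rgt) => [i|t]; rewrite /g.
    by case: (sideP i) => ->;
      rewrite ?side_simpl /= ?eqxx // [t1 == _]eq_sym (negPf t01).
  by case: (t_cases t) => ->; rewrite ?eqxx //= [t1 == _]eq_sym (negPf t01).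
rewrite -(detf_ord _ bij_g) (expand_det_row _ ord0) !big_ord_recl big_ord0
  addr0.
rewrite /cofactor !det_mx11 !mxE /g /= expr0 expr1.
by rewrite mul1r mulN1r mulrN.
Qed.

(** Met first as over-strand, the curl is triangular and contributes its two
    weights. Otherwise the loop brings the label back to the under-strand, and
    the jump completes the product of the weights to 1, as in x + (1 - x). *)
Lemma curl_det c a :
  detf (@tangle_mx F x y 1 (curl c a)) = crossing_det c \/
  detf (@tangle_mx F x y 1 (curl c a)) = 1.
Proof.
have neq : (ord0 : 'I_1, opp_side a) != (ord0, a).
  by rewrite xpair_eqE opp_neq andbF.
rewrite (@detf_two _ _ (ord0, opp_side a) (ord0, a)) //; last first.
  move=> [i b]; rewrite (ord1 i); case: (sideP b) (sideP a) => -> [] ->;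
  rewrite ?side_simpl; by [left | right].
have next (t u : 'I_1 * side) :
    [exists i, infix [:: t; u] (pstrand (curl c a) i)] =
    (t == (ord0, opp_side a)) && (u == (ord0, a)).
  apply/existsP/idP => [[i]|/andP[/eqP-> /eqP->]]; last first.
    by exists ord0; rewrite /= !eqxx.
  by rewrite /= !orbF !andbT andbF orbF.
rewrite /tangle_mx !next /twin /= !xpair_eqE !eqxx opp_sideK /=.
rewrite !eqxx opp_neq [a == _]eq_sym opp_neq /=.
rewrite !(mulr0, mulr1, addr0, add0r, subr0).
case: c {next} => [b|] /=; last by right; ring.
case: {neq} (sideP a) (sideP b) => -> [] ->; rewrite /= ?side_simpl ?eqxx /=;
  solve [left; field; by rewrite ?x0 ?y0 | right; field; by rewrite ?x0 ?y0].
Qed.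

Lemma curl_interchangeable c a : interchangeable x y (uncrossed 1) (curl c a).
Proof.
split; first exact: uncrossed_covered.
- move=> [z b]; exists ord0; rewrite /= !inE !xpair_eqE (ord1 z) /=.
  by case: (sideP b) (sideP a) => -> [] ->; rewrite /= ?side_simpl.
- move=> u; exists u; split; first exact: uncrossed_flows.
  exists (fun v => if v.2 == a then u ord0
     else (u ord0 - jump c (opp_side a) * u ord0) / weight c (opp_side a)) => i.
  rewrite (ord1 i) /= opp_sideK !eqxx opp_neq; do !split.
    by rewrite mulrC divfK ?weight_neq0 // subrK.
  case: c => [b|] /=; last by rewrite !mul0r subr0 divr1 mul1r addr0.
  by case: (sideP a) (sideP b) => -> [] ->; rewrite /= ?side_simpl;
    field; rewrite ?oppr_eq0 ?x0 ?y0 ?oner_eq0.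
- case: (curl_det c a) => dE; last first.
    by exists 0; rewrite uncrossed_det // dE mulr1.
  have [n nE] := crossing_det_power x c.
  by exists n; rewrite uncrossed_det // mulr1 -nE.
Qed.

Lemma bigon_prod c : \prod_(z < 2) crossing_det (two_kinds c z) = 1.
Proof.
by rewrite !big_ord_recl big_ord0 mulr1; exact: crossing_det_flip.
Qed.

Lemma bigon_parallel_interchangeable c : interchangeable x y (uncrossed 2)
  (bigon_parallel c).
Proof.
split; first exact: uncrossed_covered.
- move=> [z a] /=; case: (sideP z) (sideP a) => -> [] ->;
    by [exists ord0 | exists ord_max].
- move=> u; exists u; split; first exact: uncrossed_flows.
  pose f := flip_kind c; pose u0 := u ord0; pose u1 := u ord_max.
  (* The leaving labels are known to be u0 and u1, and the equations of the
     second crossing then give the labels between the crossings. *)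
  exists (fun v => if v.1 == ord0
    then if v.2 == lft then weight f rgt * u0 + jump f rgt * u1
         else weight f lft * u1 + jump f lft * u0
    else if v.2 == lft then u1 else u0) => i.
  have w1 := flip_weight x0 y0 c lft; have w2 := flip_weight x0 y0 c rgt.
  have j1 := flip_jump x0 y0 c lft; have j2 := flip_jump x0 y0 c rgt.
  rewrite !side_simpl in w1 w2 j1 j2.
  case: (sideP i) => -> /=; rewrite ?side_simpl /two_kinds /=; do !split.
    rewrite -[RHS]mulr1 -w1 -[RHS]addr0 -(mulr0 u1) -j1.
    by rewrite -[u lft]/u0 /f; ring.
  rewrite -[RHS]mulr1 -w2 -[RHS]addr0 -(mulr0 u0) -j2.
  by rewrite -[u rgt]/u1 /f; ring.
- exists 0; rewrite mul1r uncrossed_det // -(bigon_prod c).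
  (* over0 says whether the strand number 0 is the upper one. The strand of a
     port counts first in the rank, then the position on that strand. *)
  pose over0 := if c is Classical a then a == lft else true.
  pose level (v : 'I_2 * side) := ((v.1 == lft) (+) (v.2 == lft)) == over0.
  apply: (@tangle_det _ _ _ x0 y0 _ (bigon_parallel c)
    (fun v : 'I_2 * side => level v * 2 + (v.1 == rgt))%N).
    move=> [z b] /= /jump_neq0; rewrite /level /over0 /two_kinds /=.
    case: (sideP z) (sideP b) => -> [] ->; rewrite /= ?side_simpl;
    case: c {z b level over0} => [d|] //=;
    case: (sideP d) => ->; by rewrite ?side_simpl.
  by move=> i; case: (sideP i) => ->;
    rewrite /= ?side_simpl /level /= ?side_simpl; case: (over0).
Qed.

Lemma bigon_anti_interchangeable c a : interchangeable x y (uncrossed 2)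
  (bigon_anti c a).
Proof.
split; first exact: uncrossed_covered.
- move=> [z b] /=; case: (sideP z) (sideP a) (sideP b) => -> [] -> [] ->;
    rewrite ?side_simpl; by [exists ord0 | exists ord_max].
- move=> u; exists u; split; first exact: uncrossed_flows.
  pose f := flip_kind c; pose u0 := u ord0; pose u1 := u ord_max.
  (* At each crossing one label leaves the disc; the other one follows from the
     label which enters the disc there. *)
  exists (fun v => if v.1 == lft
    then if v.2 == a then u1
         else (u0 - jump c (opp_side a) * u1) / weight c (opp_side a)
    else if v.2 == a then u0
         else (u1 - jump f (opp_side a) * u0) / weight f (opp_side a)) => i.
  case: (sideP i) => -> /=;
    rewrite ?side_simpl /two_kinds /= ?opp_sideK ?opp_neq ?eqxx;
    rewrite -/f -/u0 -/u1; do !split=> //;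
    try by rewrite mulrC divfK ?weight_neq0 // subrK.
  1-2: rewrite /f {f}; move: (u0) (u1) => v0 v1.
  1-2: case: c => [b|] /=; last by rewrite !mul0r !subr0 divr1 mul1r addr0.
  1-2: by case: (sideP a) (sideP b) => -> [] ->; rewrite /= ?side_simpl;
         field; rewrite ?oppr_eq0 ?x0 ?y0 ?oner_eq0.
- exists 0; rewrite mul1r uncrossed_det // -(bigon_prod c).
  (* As for the parallel bigon; the second port of either strand is at the
     side a. *)
  pose over0 := if c is Classical b then b != a else true.
  pose level (v : 'I_2 * side) := (v.1 == lft) (+) (v.2 == a) (+) over0.
  apply: (@tangle_det _ _ _ x0 y0 _ (bigon_anti c a)
    (fun v : 'I_2 * side => level v * 2 + (v.2 == a))%N).
    move=> [z b] /= /jump_neq0; rewrite /level /over0 /two_kinds /=.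
    case: (sideP z) (sideP a) (sideP b) => -> [] -> [] ->;
    rewrite /= ?side_simpl; case: c {z b level over0} => [d|] //=;
    case: (sideP d) => ->; by rewrite ?side_simpl.
  move=> i; rewrite /level; case: (sideP i) (sideP a) => -> [] ->;
    by rewrite /= ?side_simpl /= ?side_simpl; case: (over0).
Qed.

End CurlAndBigons.

(** * Triangles *)

Section ThreeLayers.
Variables (F : fieldType) (x y : F).
Hypotheses (x0 : x != 0) (y0 : y != 0).
Local Notation weight := (weight x y).
Local Notation jump := (jump x).
Local Notation crossing_det := (crossing_det x).
Local Notation weight_neq0 := (weight_neq0 x0 y0).

(** The equations of a strand with two crossings P and Q, met in this order if
    [first] holds; inP and inQ are the labels coming in, as combinations of the
    outgoing labels. *)
Definition two_passes (first : bool) (inP inQ outP outQ u w : F) : Prop :=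
  if first then [/\ inP = u, inQ = outP & outQ = w]
  else [/\ inQ = u, inP = outQ & outP = w].

Lemma two_passesC first inP inQ outP outQ u w :
  two_passes first inP inQ outP outQ u w ->
  two_passes (~~ first) inQ inP outQ outP u w.
Proof. by case: first. Qed.

(** Three strands, at the top t, in the middle m and at the bottom b. Each of
    the crossings tm, tb, mb has as over-strand the one which comes in at otm,
    otb, omb; a virtual crossing has no influence and fits any heights. *)
Section Layers.
Variables (ctm ctb cmb : crossing_kind) (otm otb omb : side).

Local Notation over c o := (weight c o).
Local Notation under c o := (weight c (opp_side o)).
Local Notation leak c o := (jump c (opp_side o)).

Section Outputs.
Variables (p q r : bool) (t m b : F).

(** [top_at_mid] is the label going out of the crossing with the middle strand
    on the top strand, and so on. The booleans tell whether the top strand meets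
    the middle one before the bottom one (p), the middle strand meets the top
    one before the bottom one (q), the bottom strand meets the top one before
    the middle one (r). *)
Definition top_at_mid := if p then t / over ctm otm
  else t / over ctb otb / over ctm otm.
Definition top_at_bot := if p then t / over ctm otm / over ctb otb
  else t / over ctb otb.
Definition top_out := if p then top_at_bot else top_at_mid.

Definition mid_at_top :=
  ((if q then m else m / over cmb omb) - leak ctm otm * top_at_mid)
  / under ctm otm.
Definition mid_at_bot := (if q then mid_at_top else m) / over cmb omb.
Definition mid_out := if q then mid_at_bot else mid_at_top.

Definition bot_after_mid (v : F) :=
  (v - leak cmb omb * mid_at_bot) / under cmb omb.
Definition bot_at_top :=
  ((if r then b else bot_after_mid b) - leak ctb otb * top_at_bot)
  / under ctb otb.
Definition bot_at_mid := bot_after_mid (if r then bot_at_top else b).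
Definition bot_out := if r then bot_at_mid else bot_at_top.

Lemma top_passes :
  two_passes p (over ctm otm * top_at_mid) (over ctb otb * top_at_bot)
    top_at_mid top_at_bot t top_out.
Proof.
by rewrite /top_out /top_at_mid /top_at_bot; case: p; split=> //;
  rewrite mulrC divfK ?weight_neq0.
Qed.

Lemma mid_passes :
  two_passes q (under ctm otm * mid_at_top + leak ctm otm * top_at_mid)
    (over cmb omb * mid_at_bot) mid_at_top mid_at_bot m mid_out.
Proof.
by rewrite /mid_out /mid_at_bot /mid_at_top; case: q; split=> //;
  rewrite mulrC divfK ?weight_neq0 ?subrK.
Qed.

Lemma bot_passes :
  two_passes r (under ctb otb * bot_at_top + leak ctb otb * top_at_bot)
    (under cmb omb * bot_at_mid + leak cmb omb * mid_at_bot)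
    bot_at_top bot_at_mid b bot_out.
Proof.
by rewrite /bot_out /bot_at_mid /bot_at_top /bot_after_mid; case: r; split=> //;
  rewrite mulrC divfK ?weight_neq0 ?subrK.
Qed.

End Outputs.

Hypotheses (vtm : ctm = Virtual \/ ctm = Classical otm)
  (vtb : ctb = Virtual \/ ctb = Classical otb)
  (vmb : cmb = Virtual \/ cmb = Classical omb).
Hypothesis not_two :
  (is_classical ctm + is_classical ctb + is_classical cmb)%N != 2%N.

(** The algebraic core of the third move. The sides determine the orders p, q, r
    in which three straight lines meet, and moving a line across the opposite
    crossing reverses all three orders at once. With exactly two classical
    crossings the leaving labels differ in general: that move is forbidden. *)
Lemma outs_agree (t m b : F) (tau : bool) :
  let p tau := (otm != otb) == tau in
  let q tau := (omb != otm) == tau in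
  let r tau := (otb != omb) == tau in
  [/\ top_out (p tau) t = top_out (p true) t,
      mid_out (p tau) (q tau) t m = mid_out (p true) (q true) t m &
      bot_out (p tau) (q tau) (r tau) t m b =
      bot_out (p true) (q true) (r true) t m b].
Proof.
case: tau => //.
rewrite /bot_out /bot_at_mid /bot_at_top /bot_after_mid /mid_out /mid_at_bot
  /mid_at_top /top_out /top_at_mid /top_at_bot.
move: not_two; clear not_two.
case: vtm vtb vmb => -> [] -> [] -> //= _;
case: (sideP otm) (sideP otb) (sideP omb) => -> [] -> [] ->;
rewrite /= ?side_simpl /=; split; field; by rewrite ?oppr_eq0 ?x0 ?y0 ?oner_eq0.
Qed.

Lemma layers_solvable (t m b : F) : exists T M B : F, forall tau : bool,
  exists tm tb mt mb bt bm : F,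
  [/\ two_passes ((otm != otb) == tau)
        (over ctm otm * tm) (over ctb otb * tb) tm tb t T,
      two_passes ((omb != otm) == tau)
        (under ctm otm * mt + leak ctm otm * tm) (over cmb omb * mb) mt mb m M &
      two_passes ((otb != omb) == tau)
        (under ctb otb * bt + leak ctb otb * tb)
        (under cmb omb * bm + leak cmb omb * mb) bt bm b B].
Proof.
pose p tau := (otm != otb) == tau; pose q tau := (omb != otm) == tau.
pose r tau := (otb != omb) == tau.
exists (top_out (p true) t), (mid_out (p true) (q true) t m).
exists (bot_out (p true) (q true) (r true) t m b) => tau.
have [<- <- <-] := outs_agree t m b tau.
exists (top_at_mid (p tau) t), (top_at_bot (p tau) t).
exists (mid_at_top (p tau) (q tau) t m), (mid_at_bot (p tau) (q tau) t m).
exists (bot_at_top (p tau) (q tau) (r tau) t m b).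
exists (bot_at_mid (p tau) (q tau) (r tau) t m b).
by split; [exact: top_passes | exact: mid_passes | exact: bot_passes].
Qed.

End Layers.
End ThreeLayers.

Section Triangle.
Variables (F : fieldType) (x y : F).
Hypotheses (x0 : x != 0) (y0 : y != 0).
Local Notation weight := (weight x y).
Local Notation jump := (jump x).
Local Notation crossing_det := (crossing_det x).
Local Notation weight_neq0 := (weight_neq0 x0 y0).

Lemma ord3_cases (t i : 'I_3) :
  [\/ i = t, i = ord_pred t | i = ord_pred (ord_pred t)].
Proof.
case: t i => [[|[|[|]]] //= lt_t] [[|[|[|]]] //= lt_i];
  solve [by apply: Or31; apply: val_inj | by apply: Or32; apply: val_inj
        | by apply: Or33; apply: val_inj].
Qed.

Lemma ord3_pred3 (t : 'I_3) : ord_pred (ord_pred (ord_pred t)) = t.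
Proof. by case: t => [[|[|[|]]] //= lt_t]; apply: val_inj. Qed.

Lemma ord3_neq (t : 'I_3) : (ord_pred t == t) = false.
Proof. by case: t => [[|[|[|]]]]. Qed.

Lemma ord3_neq2 (t : 'I_3) : (ord_pred (ord_pred t) == t) = false.
Proof. by case: t => [[|[|[|]]]]. Qed.

Lemma eq_opp_side (a b : side) : (a == opp_side b) = (a != b).
Proof. by case: (sideP a) (sideP b) => -> [] ->; rewrite ?side_simpl. Qed.

Lemma jump_over c o : c = Virtual \/ c = Classical o -> jump c o = 0.
Proof. by case=> -> //=; rewrite eqxx. Qed.

(** The line t is on top: it is over both the line following it, at the crossing
    t, and the line preceding it, at the crossing z1. The line in the middle is
    z2, which follows t, or z1, according to the crossing z2 of these two. *)
Section Layered.
Variables (c : 'I_3 -> crossing_kind) (s o : 'I_3 -> side) (t : 'I_3).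
Local Notation z1 := (ord_pred t).
Local Notation z2 := (ord_pred (ord_pred t)).
Hypothesis co : forall i, c i = Virtual \/ c i = Classical (o i).
Hypothesis not_two :
  (forall i, is_classical (c i)) \/ exists i, forall j, j != i -> c j = Virtual.
Hypothesis over_t : o t = s t.
Hypothesis over_z1 : o z1 = opp_side (s z1).

(** A i and B i are the labels going out of the crossing i on the lines i and
    i + 1, whose ports are (i, s i) and (i, opp_side (s i)). *)
Lemma triangle_flows tau (A B u w : 'I_3 -> F) :
  (forall i, two_passes ((s i == s (ord_pred i)) == tau)
    (weight (c i) (s i) * A i + jump (c i) (s i) * B i)
    (weight (c (ord_pred i)) (opp_side (s (ord_pred i))) * B (ord_pred i)
     + jump (c (ord_pred i)) (opp_side (s (ord_pred i))) * A (ord_pred i))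
    (A i) (B (ord_pred i)) (u i) (w i)) ->
  exists S, forall i,
    @flows F x y 3 (triangle c s tau) S (u i) (pstrand (triangle c s tau) i)
      (w i).
Proof.
move=> passes; exists (fun v => if v.2 == s v.1 then A v.1 else B v.1) => i.
move: (passes i); rewrite /two_passes /=.
by case: ifP => _ [e1 e2 e3] /=; rewrite /twin /= ?opp_sideK ?eqxx ?opp_neq.
Qed.

Lemma triangle_classical_count a b d : a != b -> a != d -> b != d ->
  (is_classical (c a) + is_classical (c b) + is_classical (c d))%N != 2%N.
Proof.
move=> ab ad bd; case: not_two => [all_c|[i vi]]; first by rewrite !all_c.
have virtual j k : j = i -> k != j -> c k = Virtual.
  by move=> -> ki; exact: vi.
have [ai|/vi ->] := eqVneq a i.
  by rewrite (virtual a b) ?(virtual a d) 1?eq_sym //=; case: is_classical.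
have [bi|/vi ->] := eqVneq b i; last by rewrite /=; case: is_classical.
by rewrite (virtual b d) 1?eq_sym //=; case: is_classical.
Qed.

Let n1 : (z1 == t) = false := ord3_neq t.
Let n2 : (z2 == t) = false := ord3_neq2 t.
Let n3 : (z2 == z1) = false := ord3_neq z1.

Definition by_position (A : Type) (f g h : A) (j : 'I_3) :=
  if j == t then f else if j == z1 then g else h.

Lemma by_positionE (A : Type) (f g h : A) :
  (by_position f g h t = f) * (by_position f g h z1 = g) * (by_position f g h
    z2 = h).
Proof. by rewrite /by_position !eqxx n1 n2 n3. Qed.

Lemma negb_eqb_neg (b tau : bool) : (b == tau) = ~~ (~~ b == tau).
Proof. by case: b; case: tau. Qed.

(** The leaving labels are the same for both values of tau. The dictionary with
    [layers_solvable] depends on which line is in the middle; when it is z1, the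
    cyclic order of the heights is reversed, and tau is replaced by its
    negation. *)
Lemma triangle_transfer (u : 'I_3 -> F) : exists w : 'I_3 -> F, forall tau,
  exists S, forall i,
    @flows F x y 3 (triangle c s tau) S (u i) (pstrand (triangle c s tau) i)
      (w i).
Proof.
have st : s t = o t by [].
have s1 : s z1 = opp_side (o z1) by rewrite over_z1 opp_sideK.
have oppE (a b : side) : (opp_side a == b) = (a != b).
  by rewrite eq_sym eq_opp_side eq_sym.
have [s2|s2] : s z2 = o z2 \/ s z2 = opp_side (o z2).
  have [->|ne] := eqVneq (s z2) (o z2); [by left | right].
  by apply/eqP; rewrite eq_opp_side.
- have count : (is_classical (c t) + is_classical (c z1)
      + is_classical (c z2))%N != 2%N.
    by apply: triangle_classical_count; rewrite eq_sym ?n1 ?n2 ?n3.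
  have [T [M [B sol]]] := layers_solvable x0 y0 (co t) (co z1) (co z2) count
    (u t) (u z2) (u z1).
  exists (by_position T B M) => tau.
  have [tm [tb [mt [mb [bt [bm [tops mids bots]]]]]]] := sol tau.
  apply: (triangle_flows (A := by_position tm bt mb) (B :=
    by_position mt tb bm)) => i.
  case: (ord3_cases t i) => ->;
    rewrite ?ord3_pred3 !by_positionE ?st ?s1 ?s2 ?opp_sideK;
    rewrite ?(jump_over (co _)) ?mul0r ?addr0.
  + by rewrite eq_opp_side.
  + by rewrite oppE.
  + by rewrite negb_eqb_neg; exact: two_passesC.
- have count : (is_classical (c z1) + is_classical (c t)
      + is_classical (c z2))%N != 2%N.
    by apply: triangle_classical_count; rewrite ?n1 // eq_sym ?n2 ?n3.
  have [T [M [B sol]]] := layers_solvable x0 y0 (co z1) (co t) (co z2) count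
    (u t) (u z1) (u z2).
  exists (by_position T M B) => tau.
  have [tm [tb [mt [mb [bt [bm [tops mids bots]]]]]]] := sol (~~ tau).
  apply: (triangle_flows (A := by_position tb mt bm) (B :=
    by_position bt tm mb)) => i.
  have negtau b : (b == tau) = ~~ (b == ~~ tau) by case: b; case: (tau).
  case: (ord3_cases t i) => ->;
    rewrite ?ord3_pred3 !by_positionE ?st ?s1 ?s2 ?opp_sideK;
    rewrite ?(jump_over (co _)) ?mul0r ?addr0.
  + by rewrite eq_opp_side (eq_sym (o t)) negtau; exact: two_passesC.
  + rewrite (inj_eq (inv_inj opp_sideK)).
    have -> // : (o z1 == o z2) == tau = ((o z2 != o z1) == ~~ tau).
    by rewrite (eq_sym (o z1)); case: (o z2 == o z1); case: (tau).
  + by rewrite oppE (eq_sym (o z2)) negtau; exact: two_passesC.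
Qed.

(** The line t has height 0: heights are counted downwards. *)
Definition height (j : 'I_3) : nat :=
  if o z2 == s z2 then by_position 0 2 1 j else by_position 0 1 2 j.

Lemma height_crossing j :
  if o j == s j then (height j < height (ordS j))%N
  else (height (ordS j) < height j)%N.
Proof.
have St : ordS t = z2 by rewrite -[in LHS](ord3_pred3 t) ord_predK.
have [over1 over2] : (o t == s t) /\ (o z1 == s z1) = false.
  by rewrite over_t over_z1 opp_neq.
case: (ord3_cases t j) => ->; rewrite ?over1 ?over2 ?St ?ord_predK /height;
  by case: (o z2 == s z2); rewrite ?by_positionE.
Qed.

Lemma triangle_det tau : detf (@tangle_mx F x y 3 (triangle c s tau)) =
  \prod_z crossing_det (c z).
Proof.
(* The rank compares the heights of the lines, then the positions on them. *)
pose line (v : 'I_3 * side) := if v.2 == s v.1 then v.1 else ordS v.1.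
pose cond i := (s i == s (ord_pred i)) == tau.
pose pos (v : 'I_3 * side) := (v.2 == s v.1) (+) cond (line v).
apply: (@tangle_det _ _ _ x0 y0 _ (triangle c s tau)
  (fun v : 'I_3 * side => height (line v) * 2 + pos v)%N).
  move=> [j b] /= /jump_neq0; case: (co j) => -> // /eqP ob;
    have := height_crossing j.
  have -> : b = opp_side (o j) by rewrite ob opp_sideK.
  rewrite /twin /= opp_sideK /line /= [opp_side _ == _]eq_sym eq_opp_side [s j
    == _]eq_sym.
  case: ifP => _ /=; move: (pos _) (pos _); lia.
move=> i; rewrite /= -/(cond i); case cnd: (cond i);
  by rewrite /= /pos /line /= eqxx opp_neq /= ord_predK cnd /= andbT ltn_add2l.
Qed.

End Layered.

(** Virtual crossings leave a freedom, which is used to choose heights: with at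
    most one classical crossing, the relation over can be completed to one which
    is not cyclic. Going around the triangle, it then changes from false to true
    somewhere, which gives the top line. *)
Lemma triangle_heights c s : triangle_kinds c s ->
  exists (o : 'I_3 -> side) (t : 'I_3),
  [/\ forall i, c i = Virtual \/ c i = Classical (o i),
      (forall i, is_classical (c i)) \/
        (exists i, forall j, j != i -> c j = Virtual),
      o t = s t & o (ord_pred t) = opp_side (s (ord_pred t))].
Proof.
have choose_top (o : 'I_3 -> side) i j : o i = s i -> o j <> s j ->
    exists t, o t = s t /\ o (ord_pred t) = opp_side (s (ord_pred t)).
  move=> oi /eqP oj.
  have next k : o k = s k -> (exists t, o t = s t /\
      o (ord_pred t) = opp_side (s (ord_pred t))) \/ o (ord_pred k) = s
        (ord_pred k).
    move=> ok; have [|ne] := eqVneq (o (ord_pred k)) (s (ord_pred k));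
      first by right.
    by left; exists k; split=> //; apply/eqP; rewrite eq_opp_side.
  case: (next i oi) => // oi1; case: (next _ oi1) => // oi2.
  by case/negP: oj; apply/eqP; case: (ord3_cases i j) => ->.
case=> [cV|[i [ci vi]]|[over [co [i oi] [j oj]]]].
- pose o j := if j == ord0 then s j else opp_side (s j).
  have [| |t [ot ot1]] := choose_top o ord0 ord_max.
  + by rewrite /o eqxx.
  + by rewrite /o /=; apply/eqP; rewrite opp_neq.
  exists o, t; split=> //; [by left | right; exists t => k _; exact: cV].
- case cE: (c i) ci => [a|] // _.
  pose o j := if j == i then a else if j == ord_pred i then s j else opp_side
    (s j).
  have [| |t [ot ot1]] := choose_top o (ord_pred i) (ord_pred (ord_pred i)).
  + by rewrite /o ord3_neq eqxx.
  + by rewrite /o ord3_neq2 ord3_neq; apply/eqP; rewrite opp_neq.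
  exists o, t; split=> //; last by right; exists i.
  move=> j; rewrite /o; have [->|ji] := eqVneq j i; first by right.
  by left; exact: vi.
- have [t [ot ot1]] := choose_top over i j oi oj.
  exists over, t; split=> // [k|]; first by right.
  by left => k; rewrite co.
Qed.

Lemma triangle_covered c s tau : covered (triangle c s tau).
Proof.
move=> [z b] /=; case: (eqVneq b (s z)) => [->|bs].
  by exists z => /=; case: ifP; rewrite !inE eqxx ?orbT.
exists (ordS z) => /=; rewrite ordSK.
have -> : b = opp_side (s z) by apply/eqP; rewrite eq_opp_side.
by case: ifP; rewrite !inE eqxx ?orbT.
Qed.

Lemma triangle_interchangeable c s tau : triangle_kinds c s ->
  interchangeable x y (triangle c s tau) (triangle c s (~~ tau)).
Proof.
case/triangle_heights => o [t [co not_two ot ot1]]; split.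
- exact: triangle_covered.
- exact: triangle_covered.
- move=> u; have [w flow] := triangle_transfer co not_two ot ot1 u.
  by exists w; split; exact: flow.
- exists 0; rewrite mul1r.
  by rewrite (triangle_det co ot ot1 tau) (triangle_det co ot ot1 (~~ tau)).
Qed.

End Triangle.

(** * Moves on diagrams *)

Section DiagramMoves.
Variables (F : fieldType) (x y : F).
Hypotheses (x0 : x != 0) (y0 : y != 0).
Variable R : realType.

Definition diagram_det (X P : finType) (D : diagram_on R X P) : F :=
  detf (strand_mx x y (kind D) (follow D)).

Lemma diagram_det_carries h (X P X' P' : finType) (D : diagram_on R X P)
    (D' : diagram_on R X' P') : carries h D D' ->
  #|port X P| = #|port X' P'| /\ diagram_det D = diagram_det D'.
Proof.
case=> f [g [[[f' fK Kf] [g' gK Kg]] kE fE _ _]].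
have bij : bijective (@port_map X P X' P' f g).
  exists (port_map f' g').
    by case=> [[z a]|p] /=; rewrite ?fK ?gK.
  by case=> [[z a]|p] /=; rewrite ?Kf ?Kg.
split; first exact: bij_eq_card bij.
rewrite /diagram_det -(detf_reindex _ bij); apply: eq_detf => q t.
have thr u : through (port_map f g u) = port_map f g (through u).
  by case: u => [[]|].
rewrite /strand_mx !thr fE !(inj_eq (bij_inj bij)).
by case: (q) => [[z a]|p] /=; rewrite ?kE.
Qed.

(** The new mark is eliminated; its outgoing label is the one of the port q at
    which the subdivided edge starts. *)
Lemma diagram_det_subdivide (X P : finType) (D : diagram_on R X P) q c :
  bijective (follow D) -> bijective (follow (subdivide D q c)) ->
  diagram_det D = diagram_det (subdivide D q c).
Proof.
move=> [g gK Kg] bij'.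
pose fg (a : port X P + unit) : port X (option P) :=
  if a is inl q' then new_port q' else inr None.
have bij_fg : bijective fg.
  exists (fun t => match t with inl u => inl (inl u)
    | inr (Some p) => inl (inr p) | inr None => inr tt end).
    by case=> [[[]|]|[]].
  by case=> [[]|[]].
have new_inj : injective (@new_port X P).
  by move=> [[z a]|p] [[z' a']|p'] //= [] => [-> ->|->].
have oldK t : old_port (new_port t) = Some t :> option (port X P).
  by case: t => [[]|].
have through_new t : through (new_port t) = new_port (through t) :> port X
  (option P).
  by case: t => [[]|].
pose S (t : port X (option P)) (o : port X P) : F :=
  if old_port t is Some t0 then (t0 == o)%:R else (through q == o)%:R.
have S_new t o : S (new_port t) o = (t == o)%:R by rewrite /S oldK.
symmetry; rewrite /diagram_det (detf_reduce bij_fg (S := S)).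
- rewrite [X in _ * X](_ : _ = 1) ?mulr1; last first.
    rewrite -[RHS](detf_id F unit); apply: eq_detf => -[] [].
    rewrite /strand_mx /= mul0r addr0 mul1r.
    by case: (follow D q) => [[]|] *; rewrite subr0.
  apply: eq_detf => a o; pose b := g a.
  pose t0 : port X (option P) := if b == q then inr None else new_port b.
  have ft0 : follow (subdivide D q c) t0 = new_port a.
    rewrite /t0; have [bq|bq] := eqVneq b q; rewrite /= ?oldK.
      by rewrite -bq Kg.
    by rewrite (negPf bq) Kg.
  rewrite (strand_mx_sum _ _ _ _ (bij_inj bij') ft0) through_new !S_new.
  rewrite /strand_mx.
  have -> : S (through t0) o = (through b == o)%:R.
    rewrite /t0; have [->|bq] := eqVneq b q; first by [].
    by rewrite through_new S_new.
  have -> : (follow D (through o) == a) = (through b == o).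
    rewrite -[in LHS](Kg a) (inj_eq (can_inj gK)) -/b.
    by rewrite eq_sym (can2_eq (@throughK X P) (@throughK X P)).
  rewrite (eq_sym o) (eq_sym o).
  by case: (a) => [[]|].
- by move=> o o'; rewrite S_new.
move=> [] o; have ft0 : follow (subdivide D q c) (new_port q) = inr None.
  by rewrite /= oldK eqxx.
rewrite (strand_mx_sum _ _ _ _ (bij_inj bij') ft0) through_new S_new.
by rewrite /= mul1r mul0r addr0 subrr.
Qed.

Lemma diagram_det_glued (X P : finType) k (L L' : picture k) phi
    (ends : 'I_k + 'I_k -> P) (D : diagram_on R (X + pcrossing L)%type P)
    (D' : diagram_on R (X + pcrossing L')%type P) :
  interchangeable x y L L' ->
  bijective (follow D) -> bijective (follow D') -> injective ends ->
  shows_inside phi ends D -> shows_inside phi ends D' ->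
  agree_outside phi ends D D' ->
  exists n : int, diagram_det D' = x ^ n * diagram_det D.
Proof.
move=> [cov cov' transfer [n dets]] bij bij' inj_ends [kin sin _ _ _]
  [kin' sin' _ _ _] [kout _ _ arcs].
have [w flow] := choice (fun o : port X P => transfer
  (fun i => (o == inr (ends (inl i)))%:R)).
have [S flowS] := choice (fun o => proj1 (flow o)).
have [S' flowS'] := choice (fun o => proj2 (flow o)).
exists n; rewrite /diagram_det.
rewrite (glue_det inj_ends bij kin sin cov flowS).
rewrite (glue_det inj_ends bij' kin' sin' cov' flowS').
rewrite dets mulrCA; congr (_ * (_ * _)); apply: eq_detf => q o.
rewrite /outer_mx; congr (_ * _ + _ * _ - (_ + _)).
- by case: (q) => [[z a]|p] //=; rewrite kout.
- by case: (q) => [[z a]|p] //=; rewrite kout.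
apply: eq_bigr => r r_end; congr (_%:R * _).
have [|[q' [-> ->]] _] := arcs r.
  by move=> i rE; case/negP: r_end; apply/existsP; exists i; rewrite rE.
by rewrite (inj_eq (@outer_emb_inj _ _ _ L)) (inj_eq (@outer_emb_inj _ _ _ L')).
Qed.

End DiagramMoves.

(** * From the determinant of the definition to the strand matrix *)

Lemma det_mxdiag (F : fieldType) n (p : 'I_n -> nat)
    (B : forall i, 'M[F]_(p i)) :
  \det (\mxdiag_i B i) = \prod_i \det (B i).
Proof.
elim: n p B => [|n IH] p B.
  rewrite [RHS]big_ord0 -[RHS](det1 F (\sum_(i < 0) p i)).
  by congr (\det _); apply/matrixP => i; case: (tagnat.sig1 i).
rewrite mxdiag_recl [RHS]big_ord_recl.
have det_cast m m' (e : m = m') (A : 'M[F]_m) : \det (castmx (e, e) A) = \det A.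
  by case: m' / e; rewrite castmx_id.
by rewrite det_cast det_ublock IH.
Qed.

Lemma mxdiag2E (F : fieldType) n (B : 'I_n -> 'M[F]_2)
    (k l : 'I_(\sum_(i < n) 2)) :
  (\mxdiag_i B i) k l =
  (tagnat.sig1 k == tagnat.sig1 l)%:R
  * B (tagnat.sig1 l) (tagnat.sig2 k) (tagnat.sig2 l).
Proof.
rewrite !mxE; have [->|_] := eqVneq (tagnat.sig1 k) (tagnat.sig1 l).
  by rewrite conform_mx_id mul1r.
by rewrite mxE mul0r.
Qed.

Section Bridge.
Variables (R : realType) (X P : finType) (D : diagram_on R X P).
Hypothesis bij_follow : bijective (follow D).
Local Notation x := xvar.
Local Notation y := yvar.
Local Notation T := (port X P).
Local Notation n := #|classical_crossing D|.
Local Notation classical := (is_classical_port D).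

Lemma xvar_neq0 : xvar != 0.
Proof. by rewrite tofrac_eq0 polyC_eq0 polyX_eq0. Qed.

Lemma yvar_neq0 : yvar != 0.
Proof. by rewrite tofrac_eq0 polyX_eq0. Qed.

Definition next_port (q : T) : T := follow D (through q).

Lemma classical_through q : classical (through q) = classical q.
Proof. by case: q => [[]|]. Qed.

Lemma weight_bare q : ~~ classical q -> port_weight x y (kind D) q = 1.
Proof. by case: q => [[z a]|p] //=; case: (kind D z). Qed.

Lemma jump_bare q : ~~ classical q -> port_jump x (kind D) q = 0.
Proof. by case: q => [[z a]|p] //=; case: (kind D z). Qed.

Local Notation turn := (fun u : T => through (follow D u)).

Lemma turn_inj : injective turn.
Proof. exact: inj_comp (inv_inj (@throughK X P)) (bij_inj bij_follow). Qed.

(** The labels are 1 along the bare curve and 0 elsewhere: no crossing on it is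
    classical, so that its rows only compare consecutive labels. *)
Lemma det_bare_curve : has_bare_curve D -> diagram_det x y D = 0.
Proof.
case/existsP => q /forallP bare.
have {}bare r : fconnect turn q r -> ~~ classical r.
  by move=> qr; have := bare r; rewrite qr.
pose S (t : T) : ratfrac := (fconnect turn q (through t))%:R.
apply: (@detf_kernel _ _ _ S (through q)).
  by rewrite /S throughK connect0 oner_eq0.
move=> a; have [g gK Kg] := bij_follow; have ft := Kg a.
rewrite (strand_mx_sum _ _ _ _ (bij_inj bij_follow) ft) /S !throughK.
have <- : fconnect turn q (through a) = fconnect turn q (g a).
  by rewrite -{1}ft (fconnect_sym turn_inj) -(same_fconnect1 turn_inj)
    (fconnect_sym turn_inj).
case qa: (fconnect turn q (through a)).
  have na : ~~ classical a by rewrite -classical_through bare.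
  by rewrite weight_bare // jump_bare // mul1r mul0r addr0 subrr.
have [|na] := boolP (classical a).
  case qa': (fconnect turn q a); first by rewrite (negPf (bare _ qa')).
  by rewrite !mulr0 addr0 subr0.
by rewrite weight_bare // jump_bare // mul1r mul0r addr0 subrr.
Qed.

Definition classical_step (r : T) : T := if classical r then r else next_port r.
(** By conversion, [next_classical D q] is [first_classical (follow D q)]. *)
Definition first_classical (r : T) : T := iter #|{: T}| classical_step r.

Lemma step_classical m r : classical r -> iter m classical_step r = r.
Proof. by move=> cr; elim: m => [//|m IH];
  rewrite iterS IH /classical_step cr. Qed.

Lemma iter_step m k r : (k <= m)%N -> classical (iter k next_port r) ->
  classical (iter m classical_step r).
Proof.
elim: m k r => [|m IH] [|k] r // km ck; first by rewrite step_classical.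
rewrite iterSr {2}/classical_step; case: ifP => cr;
  first by rewrite step_classical.
by apply: IH km _; rewrite -iterSr.
Qed.

Section NoBareCurve.
Hypothesis no_bare : ~~ has_bare_curve D.

(** An orbit has at most as many points as there are ports, which bounds the
    number of steps. *)
Lemma reach_classical r :
  exists2 k, (k <= #|{: T}|)%N & classical (iter k next_port r).
Proof.
move: no_bare; rewrite negb_exists => /forallP/(_ (through r)).
rewrite negb_forall => /existsP[c]; rewrite negb_imply negbK => /andP[rc cc].
exists (findex turn (through r) c).
  apply: leq_trans (ltnW (findex_max rc)) _.
  exact: max_card.
rewrite -classical_through;
  suff -> : through (iter (findex turn (through r) c) next_port r) = c by [].
rewrite -[RHS](iter_findex rc); elim: (findex _ _ _) => [//|k IH].
by rewrite !iterS -IH.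
Qed.

Lemma classical_first r : classical (first_classical r).
Proof. by have [k kN ck] := reach_classical r; exact: iter_step kN ck. Qed.

Lemma first_next r : ~~ classical r -> first_classical (next_port r) =
  first_classical r.
Proof.
move=> nr; have <- : classical_step r = next_port r
  by rewrite /classical_step (negPf nr).
rewrite /first_classical -iterSr iterS {1}/classical_step.
by rewrite [iter _ _ _]/(first_classical r) classical_first.
Qed.

Let wait r : exists k, classical (iter k next_port r).
Proof. by have [k _ ck] := reach_classical r; exists k. Qed.

Definition delay r : nat := ex_minn (wait r).

Lemma delay_next r : ~~ classical r -> (delay (next_port r) < delay r)%N.
Proof.
rewrite /delay; case: ex_minnP => k ck mink; case: ex_minnP => -[|m] cm minm nr.
  by rewrite cm in nr.
by rewrite ltnS mink // -iterSr.
Qed.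

Local Notation index := 'I_(\sum_(i < n) 2).
Definition at_index (k : index) : T := inl (cl (tagnat.sig1 k), tagnat.sig2 k).

Lemma at_index_classical k : classical (at_index k).
Proof. by have := enum_valP (tagnat.sig1 k); rewrite inE. Qed.

Lemma at_index_Rank i a : at_index (tagnat.Rank i a) = inl (cl i, a).
Proof.
rewrite /at_index; congr (inl (cl _, _)); first exact: tagnat.Rank1K.
apply: val_inj; rewrite /= (tagnat.Rank2K (p_ := fun=> 2%N)). by [].
Qed.

Lemma at_index_inj : injective at_index.
Proof.
move=> k l [/enum_val_inj e1 e2].
rewrite -(tagnat.sig2K k) -(tagnat.sig2K l); apply: val_inj; apply/eqP.
by rewrite (tagnat.eq_Rank (p_ := fun=> 2%N)) e1 e2 !eqxx.
Qed.

Lemma at_index_eq k i a :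
  (at_index k == inl (cl i, a)) = (tagnat.sig1 k == i) && (tagnat.sig2 k == a).
Proof.
by apply/eqP/andP=> [[/enum_val_inj -> ->]|[/eqP <- /eqP <-]].
Qed.

Lemma at_index_surj q : classical q -> exists k, at_index k = q.
Proof.
case: q => [[z a]|p] //= cz;
  have zin : z \in classical_crossing D by rewrite inE.
exists (tagnat.Rank (enum_rank_in zin z) a).
by rewrite at_index_Rank /cl enum_rankK_in.
Qed.

Local Notation B := (strand_mx x y (kind D) (follow D)).

Lemma strand_mx_col_sum (S : T -> ratfrac) r :
  \sum_t B t r * S t =
    port_weight x y (kind D) r * S r
    + port_jump x (kind D) (through r) * S (through r) - S (next_port r).
Proof.
have pick (f : T -> ratfrac) q : \sum_i (i == q)%:R * f i = f q.
  rewrite (bigD1 q) //= eqxx mul1r big1 ?addr0 // => i /negPf ->.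
  by rewrite mul0r.
rewrite -(pick S (next_port r)) -(pick (fun t => port_weight x y (kind D) t *
  S t)).
rewrite -(pick (fun t => port_jump x (kind D) t * S t)) -big_split -sumrB /=.
apply: eq_bigr => t _; rewrite /strand_mx -/(next_port r) !(eq_sym t).
by rewrite (can2_eq (@throughK X P) (@throughK X P)); ring.
Qed.

Definition reduced_mx (o o' : index) : ratfrac :=
  port_weight x y (kind D) (at_index o') * (o' == o)%:R
  + port_jump x (kind D) (through (at_index o'))
    * (through (at_index o') == at_index o)%:R
  - (first_classical (next_port (at_index o')) == at_index o)%:R.

(** The ports which are not classical are eliminated, this time by row
    operations, hence the transposition: adding all rows on the way to a
    classical port short-circuits the ways without classical crossings. The
    inner block is triangular with respect to the number of steps which remain
    before a classical port is met. *)
Lemma diagram_det_reduced : diagram_det x y D = detf reduced_mx.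
Proof.
pose fg (a : index + {r : T | ~~ classical r}) : T :=
  match a with inl k => at_index k | inr r => val r end.
have fg_inj : injective fg.
  move=> [k|[r nr]] [l|[r' nr']] /=.
  - by move/at_index_inj ->.
  - by move=> kr; case/negP: (nr'); rewrite -kr at_index_classical.
  - by move=> rl; case/negP: (nr); rewrite rl at_index_classical.
  - by move=> rr; congr inr; apply: val_inj.
have [g gK] : exists g, forall t, fg (g t) = t.
  suff /choice[g gK] t : exists a, fg a = t by exists g.
  have [ct|nt] := boolP (classical t).
    by have [k <-] := at_index_surj ct; exists (inl k).
  by exists (inr (exist _ t nt)).
have bij_fg : bijective fg by exists g => [a|//]; apply: fg_inj; rewrite gK.
pose S t o : ratfrac := (first_classical t == at_index o)%:R.
have S_index o' o : S (at_index o') o = (o' == o)%:R.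
  rewrite /S /first_classical step_classical ?at_index_classical //.
  by rewrite (inj_eq at_index_inj).
rewrite /diagram_det -detf_tr (detf_reduce bij_fg (S := S)) //; last first.
  move=> [r nr] o /=; rewrite (strand_mx_col_sum (S^~ o)) weight_bare //
    jump_bare.
    by rewrite mul0r addr0 mul1r /S first_next // subrr.
  by rewrite classical_through.
rewrite [X in _ * X](_ : _ = 1) ?mulr1.
  rewrite -detf_tr; apply: eq_detf => o o' /=.
  rewrite (strand_mx_col_sum (S^~ o)) S_index /S /first_classical.
  by rewrite (@step_classical _ (through _)) ?classical_through
    ?at_index_classical.
have layer r : ~~ classical r -> next_port r != r.
  by move=> nr; apply: contraTneq (delay_next nr) => ->; rewrite ltnn.
have entry (r r' : {r : T | ~~ classical r}) :
    B (val r') (val r) = (r == r')%:R - (next_port (val r) == val r')%:R.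
  rewrite /strand_mx weight_bare ?jump_bare ?(valP r') //.
  by rewrite mul1r mul0r addr0 (inj_eq val_inj).
rewrite (@detf_layered _ _ _ (fun r => delay (val r))) => [|r r' /=].
  apply: big1 => r _ /=; rewrite entry eqxx (negPf (layer _ (valP r))).
  by rewrite subr0.
rewrite entry; have [->|_] := eqVneq r r'; first by left.
have [<-|_] := eqVneq (next_port (val r)) (val r'); last by rewrite subrr eqxx.
by move=> _; right; apply: delay_next (valP r).
Qed.

Definition swap_index (k : index) : index :=
  tagnat.Rank (tagnat.sig1 k) (opp_side (tagnat.sig2 k)).

Lemma at_swap k : at_index (swap_index k) = through (at_index k).
Proof. by rewrite at_index_Rank. Qed.

Definition swap_mx : 'M[ratfrac]_2 := \matrix_(a, b) (a == opp_side b)%:R.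

Lemma det_swap : \det swap_mx = -1.
Proof.
rewrite (expand_det_row _ ord0) !big_ord_recl big_ord0 /cofactor !det_mx11
  !mxE /=.
by rewrite mul0r add0r addr0 expr1 mulr1 mul1r.
Qed.

Lemma kind_matrix (i : 'I_n) (a b : side) :
  (if is_positive (kind D (cl i)) then Mplus else Mminus) b a =
    weight x y (kind D (cl i)) (opp_side a) * (b == opp_side a)%:R
    + jump x (kind D (cl i)) a * (b == a)%:R.
Proof.
have := enum_valP i; rewrite inE -/(cl i); case: (kind D (cl i)) => [c|] // _.
by rewrite -crossing_entries /=; case: ifP => _; rewrite mxE.
Qed.

(** The columns of M - P are the outgoing ports, those of the strand matrix are
    named after the incoming port of the same strand. *)
Lemma state_mx_swap :
  (Mmx D - Pmx D) *m \mxdiag_(i < n) swap_mx = \matrix_(o, o') reduced_mx o o'.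
Proof.
have swapE o o' : (\mxdiag_(i < n) swap_mx) o o' = (o == swap_index o')%:R.
  rewrite mxdiag2E -(inj_eq at_index_inj) at_swap at_index_eq.
  by rewrite mxE -natrM mulnb.
apply/matrixP=> o o';
  rewrite 2!mxE (bigD1 (swap_index o')) //= [X in _ + X]big1 ?addr0.
  have [s1 s2] : tagnat.sig1 (swap_index o') = tagnat.sig1 o' /\
                 tagnat.sig2 (swap_index o') = opp_side (tagnat.sig2 o').
    have := eqxx (through (at_index o')); rewrite -{1}at_swap /=.
    by rewrite at_index_eq => /andP[/eqP -> /eqP ->].
  rewrite swapE eqxx mulr1 mxE [X in _ + X]mxE /Mmx /Pmx mxdiag2E mxE mxE.
  rewrite !s1 !s2 kind_matrix opp_sideK /reduced_mx.
  congr (_ - _).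
  have -> : (o' == o) = (tagnat.sig1 o == tagnat.sig1 o') &&
                        (tagnat.sig2 o == tagnat.sig2 o').
    by rewrite eq_sym -(inj_eq at_index_inj); exact: at_index_eq.
  have -> : (through (at_index o') == at_index o) =
      (tagnat.sig1 o == tagnat.sig1 o') &&
      (tagnat.sig2 o == opp_side (tagnat.sig2 o')).
    by rewrite eq_sym; exact: at_index_eq.
  by rewrite -!mulnb !natrM mulrDr mulrCA [X in _ + X]mulrCA.
by move=> k /negPf ks; rewrite swapE ks mulr0.
Qed.

Lemma sign_writhe : ((-1) ^ writhe D : ratfrac) = (-1) ^+ n.
Proof.
rewrite /writhe -sum1_card; elim/big_rec2: _ => [|z m k zin IH];
  first by rewrite expr0z.
by rewrite exprzDr ?unitrN1 // IH exprS; case: ifP => _;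
  rewrite ?expr1z ?exprN1 ?invrN1.
Qed.

Lemma ZD_no_bare : (0 < n)%N -> ZD D = diagram_det x y D.
Proof.
move=> n_pos; rewrite /ZD (negPf no_bare) orbF eqn0Ngt n_pos /=.
rewrite sign_writhe diagram_det_reduced -(detf_ord reduced_mx (g := id));
  last by exists id.
rewrite -state_mx_swap det_mulmx det_mxdiag prodr_const card_ord det_swap.
by rewrite mulrC.
Qed.

End NoBareCurve.

(** A nonempty diagram without classical crossings has a bare curve. The empty
    diagram is the only one for which the two determinants differ from ZD: it
    has ZD = 0, while a determinant of size 0 is 1. *)
Lemma ZD_det : ZD D = if #|{: T}| == 0%N then 0 else diagram_det x y D.
Proof.
have [noport|/card_gt0P[q _]] := posnP #|{: T}|.
  rewrite /ZD; have -> // : n == 0%N.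
  apply/eqP/eq_card0 => z; have := fintype0 (inl (z, lft) : T).
  by rewrite noport => /(_ erefl).
have [bare|no_bare] := boolP (has_bare_curve D).
  by rewrite /ZD bare orbT det_bare_curve.
apply: ZD_no_bare => //; have := classical_first no_bare q.
case: (first_classical q) => [[z a]|p] //= cz; apply/card_gt0P; exists z.
by rewrite inE.
Qed.

End Bridge.

(** * Laurent polynomials *)

Section Laurent.

Let X0 m : xvar ^+ m != 0. Proof. by rewrite expf_neq0 // xvar_neq0. Qed.
Let Y0 m : yvar ^+ m != 0. Proof. by rewrite expf_neq0 // yvar_neq0. Qed.

Lemma laurentM a b : is_laurent a -> is_laurent b -> is_laurent (a * b).
Proof.
case=> [p [m [n ->]]] [q [k [l ->]]]; exists (p * q), (m + k)%N, (n + l)%N.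
by rewrite mulf_div [in LHS]mulrACA tofracM !exprD.
Qed.

Lemma laurentD a b : is_laurent a -> is_laurent b -> is_laurent (a + b).
Proof.
case=> [p [m [n ->]]] [q [k [l ->]]].
exists (p * ('X%:P ^+ k * 'X ^+ l) + q * ('X%:P ^+ m * 'X ^+ n)).
exists (m + k)%N, (n + l)%N.
rewrite addf_div ?(mulf_neq0 (X0 _) (Y0 _)) // [_ ^+ m * _ * (_ * _)]mulrACA
  -!exprD.
by rewrite tofracD !tofracM !tofracXn.
Qed.

Lemma laurent_poly p : is_laurent (FracField.tofrac p).
Proof. by exists p, 0%N, 0%N; rewrite !expr0 mulr1 divr1. Qed.

Lemma laurent0 : is_laurent 0.
Proof. by rewrite -(tofrac0 {poly {poly int}}); exact: laurent_poly. Qed.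

Lemma laurent1 : is_laurent 1.
Proof. by rewrite -(tofrac1 {poly {poly int}}); exact: laurent_poly. Qed.

Lemma laurentN a : is_laurent a -> is_laurent (- a).
Proof.
by case=> [p [m [n ->]]]; exists (- p), m, n; rewrite tofracN mulNr.
Qed.

Lemma laurentB a b : is_laurent a -> is_laurent b -> is_laurent (a - b).
Proof. by move=> la lb; apply: laurentD => //; apply: laurentN. Qed.

Lemma laurent_bool (b : bool) : is_laurent b%:R.
Proof. by case: b; [exact: laurent1 | exact: laurent0]. Qed.

Lemma laurent_x : is_laurent xvar. Proof. exact: laurent_poly. Qed.
Lemma laurent_y : is_laurent yvar. Proof. exact: laurent_poly. Qed.

Lemma laurent_xV : is_laurent xvar^-1.
Proof. by exists 1, 1%N, 0%N; rewrite tofrac1 expr1 expr0 mulr1 div1r. Qed.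

Lemma laurent_yV : is_laurent yvar^-1.
Proof. by exists 1, 0%N, 1%N; rewrite tofrac1 expr1 expr0 !mul1r. Qed.

Lemma laurent_det n (A : 'M[ratfrac]_n) :
  (forall i j, is_laurent (A i j)) -> is_laurent (\det A).
Proof.
move=> lA; apply: big_ind => [|a b|s _]; [exact: laurent0 | exact: laurentD | ].
apply: laurentM.
  by case: (odd_perm s); rewrite ?expr0 ?expr1; [apply: laurentN|];
    exact: laurent1.
by apply: big_ind => [|a b|i _];
  [exact: laurent1 | exact: laurentM | exact: lA].
Qed.

Lemma laurent_weight c b : is_laurent (weight xvar yvar c b).
Proof.
have xyV := laurentM laurent_x laurent_yV.
have yxV := laurentM laurent_y laurent_xV.
case: c => [a|] /=; last exact: laurent1.
do 2 case: ifP => _; apply: laurentN => //;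
  [exact: laurent_y | exact: laurent_yV].
Qed.

Lemma laurent_jump c b : is_laurent (jump xvar c b).
Proof.
case: c => [a|] /=; last exact: laurent0.
case: ifP => _; first exact: laurent0.
by case: ifP => _; apply: laurentB;
  [exact: laurent1|exact: laurent_x|exact: laurent1|exact: laurent_xV].
Qed.

Lemma laurent_diagram_det (R : realType) (X P : finType) (D : diagram_on R X
  P) :
  is_laurent (diagram_det xvar yvar D).
Proof.
apply: laurent_det => i j; rewrite mxE /strand_mx.
apply: laurentB; last exact: laurent_bool.
apply: laurentD; apply: laurentM; try exact: laurent_bool.
  by case: (enum_val i) => [u|p] /=; [exact: laurent_weight | exact: laurent1].
by case: (enum_val i) => [u|p] /=; [exact: laurent_jump | exact: laurent0].
Qed.

End Laurent.

(** * Invariance *)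

Lemma reidemeister_interchangeable k (L L' : picture k) :
  extended_reidemeister L L' -> (0 < k)%N /\ interchangeable xvar yvar L L'.
Proof.
have [x0 y0] := (xvar_neq0, yvar_neq0).
case=> [c a|c|c a|c s tau kinds]; split=> //.
- exact: curl_interchangeable.
- exact: bigon_parallel_interchangeable.
- exact: bigon_anti_interchangeable.
- exact: triangle_interchangeable.
Qed.

Lemma ZD_elementary (R : realType) (D D' : virtual_link_diagram R) :
  elementary_equivalence D D' -> exists k : int, ZD D' = xvar ^ k * ZD D.
Proof.
case=> [h {}D {}D' _ /diagram_det_carries car | {}D q c subP _
  | X P k L L' phi ends {}D {}D' DP DP' moves _ inj_ends inside inside'
    outside].
- have [cardE detE] := car _ xvar yvar.
  exists 0; rewrite mul1r !ZD_det ?cardE ?detE //; apply: follow_bij;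
    exact: diagramP.
- have bij := follow_bij (diagramP D); have bij' := follow_bij subP.
  exists 0; rewrite mul1r !ZD_det //= -(diagram_det_subdivide _ _ bij bij').
  have q_pos (T : finType) (r : T) : (#|{: T}| == 0%N) = false.
    by apply/negbTE; rewrite -lt0n; apply/card_gt0P; exists r.
  by rewrite (q_pos _ q) (q_pos _ (inr None : port (crossing D) (option (mark
    D)))).
have [k_pos inter] := reidemeister_interchangeable moves.
have bij := follow_bij DP; have bij' := follow_bij DP'.
have [n detE] := diagram_det_glued inter bij bij' inj_ends inside inside'
  outside.
have q_pos (Y : finType) : (#|{: port (X + Y)%type P}| == 0%N) = false.
  apply/negbTE; rewrite -lt0n; apply/card_gt0P.
  by exists (inr (ends (inl (Ordinal k_pos)))).
by exists n; rewrite !ZD_det //= !q_pos.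
Qed.

Theorem theorem1 (R : realType) :
  (forall D : virtual_link_diagram R, is_laurent (ZD D)) /\
  (forall D D' : virtual_link_diagram R, equivalent D D' ->
     exists k : int, ZD D = xvar ^ k * ZD D').
Proof.
split=> [D|D D'].
  rewrite (ZD_det (follow_bij (diagramP D))); case: ifP => _;
    first exact: laurent0.
  exact: laurent_diagram_det.
have sym (E E' : virtual_link_diagram R) k :
    ZD E' = xvar ^ k * ZD E -> ZD E = xvar ^ (- k) * ZD E'.
  by move=> ->; rewrite mulrA -expfzDr ?xvar_neq0 // addNr mul1r.
elim=> [E E' /ZD_elementary[k /sym ->]|E|E E' _ [k eqE]|E E' E'' _ [k ->] _ [l
  ->]].
- by exists (- k).
- by exists 0; rewrite mul1r.
- by exists (- k); exact: sym.
by exists (k + l); rewrite expfzDr ?xvar_neq0 // mulrA.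
Qed.
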